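(* For any integers $n\ge m\ge0$ we have $$\mu_n|_{\mathrm{Sch}_m}\ =\ \frac{C_n^2}{C_m^2\,C_{n-m}}\cdot\mu_m|_{\mathrm{Sch}_m}.$$
   Context: Fix a prime $p>2$ and a group $\{1,\sigma\}$ of order $2$. All homomorphisms of pro-$p$-groups are continuous, all subgroups are closed, and ''generated'' means topologically generated. A $\sigma$-pro-$p$-group is a pro-$p$-group $G$ with a continuous action of $\{1,\sigma\}$, written $a\mapsto{}^\sigma a$; $\sigma$-homomorphisms and $\sigma$-isomorphisms are the $\sigma$-equivariant ones. Put $G^-:=\{a\in G\mid {}^\sigma a=a^{-1}\}$. Let $d_G:=\dim_{\mathbb F_p}H^1(G,\mathbb F_p)$ be the minimal number of generators of $G$. Let $D_i(G)$ ($i\ge1$) be the Zassenhaus filtration (dimension subgroups mod $p$): $D_1(G)=G$, and $D_i(G)$ is generated by the $p$-th powers of elements of $D_{\lceil i/p\rceil}(G)$ and all $[D_j(G),D_k(G)]$ with $j+k=i$. $F_n$ is the free pro-$p$-group on $x_1,\dots,x_n$, made a $\sigma$-pro-$p$-group by ${}^\sigma x_i=x_i^{-1}$. For $r=(r_1,\dots,r_n)\in(F_n^-)^n$ let $N_r$ be the normal subgroup of $F_n$ generated by all conjugates of $r_1,\dots,r_n$, and $G_r:=F_n/N_r$. A weak Schur $\sigma$-group is a $\sigma$-pro-$p$-group $\sigma$-isomorphic to some $G_r$ with $n\ge0$, $r\in(F_n^-)^n$. $\mathrm{Sch}$ is the set of $\sigma$-isomorphism classes $[G]$ of weak Schur $\sigma$-groups,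 and $\mathrm{Sch}_m:=\{[G]\in\mathrm{Sch}\mid d_G=m\}$. $\mathrm{Sch}$ carries the topology with basis the sets $U_{i,G}:=\{[H]\in\mathrm{Sch}\mid H/D_i(H)\cong G/D_i(G)\ \sigma\text{-isomorphic}\}$ for all $i\ge2$ and all weak Schur $\sigma$-groups $G$. The Haar measure on $F_n^-$ is the unique Borel probability measure such that for every $\sigma$-invariant open normal subgroup $N\triangleleft F_n$ every fiber of the (surjective) map $F_n^-\to(F_n/N)^-$ has measure $1/|(F_n/N)^-|$. Let $\tilde\mu_n$ be the product measure on $(F_n^-)^n$, and let $\mu_n$ be its pushforward, a Borel probability measure on $\mathrm{Sch}$, under the continuous map $(F_n^-)^n\to\mathrm{Sch}$, $r\mapsto[G_r]$. The restriction $\mu|_{\mathrm{Sch}_m}$ is the measure $A\mapsto\mu(A\cap\mathrm{Sch}_m)$. For integers $k\ge0$ put $C_k:=\prod_{i=1}^k(1-p^{-i})$. *)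

(* Defs.v *)
From HB Require Import structures.
From mathcomp Require Import all_boot all_order all_algebra zify finmap.
From mathcomp Require Import all_classical all_reals all_analysis.

Set Implicit Arguments.
Unset Strict Implicit.
Unset Printing Implicit Defensive.

Import Order.TTheory GRing.Theory Num.Theory.

Local Open Scope classical_set_scope.
Local Open Scope group_scope.

HB.mixin Record Group_isTopGroup G of Group G & Topological G := {
  mulg_continuous : continuous (fun xy : G * G => xy.1 * xy.2);
  invg_continuous : continuous (fun x : G => x^-1)
}.

#[short(type="topGroupType")]
HB.structure Definition TopGroup :=
  {G of Group G & Topological G & Group_isTopGroup G}.

(* A continuous action of {1, sigma} is a continuous involutive automorphism. *)
HB.mixin Record TopGroup_isSigmaGroup G of TopGroup G := {
  sigma : G -> G;
  sigmaM : {morph sigma : x y / x * y};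
  sigmaK : involutive sigma;
  sigma_continuous : continuous sigma
}.

#[short(type="sigmaGroupType")]
HB.structure Definition SigmaGroup :=
  {G of TopGroup G & TopGroup_isSigmaGroup G}.

Section Subgroups.
Variable G : topGroupType.
Implicit Types (A B H S : set G).

Definition is_subgroup H :=
  [/\ H 1, forall x y, H x -> H y -> H (x * y) & forall x, H x -> H x^-1].

Definition is_normal H := forall x g, H x -> H (x ^ g).

(* "generated" always means topologically generated *)
Definition cgen S : set G := smallest [set H | is_subgroup H /\ closed H] S.

Definition csubcomm A B : set G := cgen [set [~ x, y] | x in A & y in B].

Definition lcoset_set H : set (set G) := [set [set x * h | h in H] | x in setT].

Definition is_profinite :=
  [/\ compact [set: G], hausdorff_space G &
      forall U : set G, nbhs 1 U -> exists H, [/\ is_subgroup H, open H & H `<=` U]].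

Definition is_pro_p (p : nat) :=
  is_profinite /\
  forall H, is_subgroup H -> is_normal H -> open H ->
    exists k : nat, (lcoset_set H #= `I_(p ^ k))%card.

(* The dimension subgroups D_i. The fuel k only bounds the depth of the
   recursion on i; the recursive equation itself is [zassenhausE]. *)
Fixpoint zassenhaus_rec (p k i : nat) : set G :=
  if k is k'.+1 then
    if i <= 1 then setT else
    cgen ([set x ^+ p | x in zassenhaus_rec p k' ((i + p.-1) %/ p)] `|`
          \bigcup_(jl in [set jl : nat * nat |
                           [/\ 0 < jl.1, 0 < jl.2 & jl.1 + jl.2 = i]%N])
            csubcomm (zassenhaus_rec p k' jl.1) (zassenhaus_rec p k' jl.2))
  else setT.

Definition zassenhaus (p i : nat) : set G := zassenhaus_rec p i i.

End Subgroups.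

Definition is_cmorph (G H : topGroupType) (f : G -> H) :=
  continuous f /\ {morph f : x y / x * y}.

Section SubgroupTheory.
Variable G : topGroupType.
Implicit Types (A B H S : set G).

Lemma cgen_subgroup S : is_subgroup (cgen S).
Proof.
split=> [H [[[]]] //|x y Sx Sy H HS|x Sx H HS].
  case: (HS) => -[[_ HM _] _] _; exact: HM (Sx _ HS) (Sy _ HS).
case: (HS) => -[[_ _ HV] _] _; exact: HV (Sx _ HS).
Qed.

Lemma cgen_closed S : closed (cgen S).
Proof. by apply: closed_bigI => H [[]]. Qed.

Lemma sub_cgen S : S `<=` cgen S.
Proof. exact: sub_gen_smallest. Qed.

Lemma cgen_min S H : is_subgroup H -> closed H -> S `<=` H -> cgen S `<=` H.
Proof. by move=> gH cH; apply: smallest_sub. Qed.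

Lemma csubcommS A B A' B' :
  A `<=` A' -> B `<=` B' -> csubcomm A B `<=` csubcomm A' B'.
Proof.
move=> sA sB; apply: cgen_min; [exact: cgen_subgroup|exact: cgen_closed|].
by move=> _ [x Ax [y By <-]]; apply: sub_cgen; exists x; [exact: sA|];
  exists y; [exact: sB|].
Qed.

Lemma zassenhaus_rec_subgroup p k i : is_subgroup (@zassenhaus_rec G p k i).
Proof. by case: k => [//|k] /=; case: ifP => // _; exact: cgen_subgroup. Qed.

Lemma zassenhaus_rec_closed p k i : closed (@zassenhaus_rec G p k i).
Proof.
by case: k => [|k] /=; [exact: closedT|case: ifP => _; [exact: closedT|exact: cgen_closed]].
Qed.

Lemma zassenhaus_recS p k k' i i' : (k <= k')%N -> (i <= i')%N ->
  @zassenhaus_rec G p k' i' `<=` @zassenhaus_rec G p k i.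
Proof.
elim: k k' i i' => [//|k IHk] [//|k'] i i' lek lei /=.
case: (leqP i 1) => // i1; rewrite leqNgt (leq_trans i1 lei) /=.
apply: cgen_min; [exact: cgen_subgroup|exact: cgen_closed|].
move=> z [[x Dx <-]|[[j l] /= [j0 l0 jl] Dz]]; apply: sub_cgen.
  by left; exists x => //; apply: IHk Dx => //; rewrite leq_div2r ?leq_add2r.
right; have [j1 [l1 [[j10 l10 jl1] [lej lel]]]] : exists j1 l1,
    [/\ 0 < j1, 0 < l1 & j1 + l1 = i]%N /\ (j1 <= j /\ l1 <= l)%N.
  have [ji|ij] := leqP j i.-1.
    by exists j, (i - j)%N; split; split; lia.
  by exists i.-1, 1%N; split; split; lia.
exists (j1, l1) => //=; apply: csubcommS Dz; exact: IHk.
Qed.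

Lemma zassenhaus_rec_fuel p k k' i : (1 < p)%N -> (i <= k)%N -> (i <= k')%N ->
  @zassenhaus_rec G p k i = zassenhaus_rec p k' i.
Proof.
move=> p1; elim: k k' i => [|k IHk] [|k'] i //=.
- by rewrite leqn0 => /eqP ->.
- by move=> _; rewrite leqn0 => /eqP ->.
move=> ik ik'; case: (leqP i 1) => // i1.
have ci : ((i + p.-1) %/ p < i)%N by rewrite ltn_divLR; nia.
rewrite (IHk k' _); [|lia..]; congr (cgen (_ `|` _)).
by apply: eq_bigcupr => -[j l] /= [j0 l0 jl]; congr csubcomm; apply: IHk; lia.
Qed.

Lemma zassenhaus1 p : @zassenhaus G p 1 = setT.
Proof. by []. Qed.

Lemma zassenhausE p i : (1 < p)%N -> (1 < i)%N ->
  @zassenhaus G p i =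
  cgen ([set x ^+ p | x in zassenhaus p ((i + p.-1) %/ p)] `|`
        \bigcup_(jl in [set jl : nat * nat |
                         [/\ 0 < jl.1, 0 < jl.2 & jl.1 + jl.2 = i]%N])
          csubcomm (zassenhaus p jl.1) (zassenhaus p jl.2)).
Proof.
move=> p1 i1; have ci : ((i + p.-1) %/ p < i)%N by rewrite ltn_divLR; nia.
rewrite /zassenhaus; case: i => // i in i1 ci *.
rewrite [LHS]/= leqNgt i1 /=; congr (cgen (_ `|` _)).
  by congr image; apply: zassenhaus_rec_fuel => //; lia.
apply: eq_bigcupr => -[j l] /= [j0 l0 jl].
by congr csubcomm; apply: zassenhaus_rec_fuel => //; lia.
Qed.


End SubgroupTheory.

Section GroupMorphisms.
Variables (G H : groupType) (f : G -> H).
Hypothesis fM : {morph f : x y / x * y}.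

Lemma morph1 : f 1 = 1.
Proof. by apply: (mulgI (f 1)); rewrite -fM !mulg1. Qed.

Lemma morphV x : f x^-1 = (f x)^-1.
Proof. by apply: (mulgI (f x)); rewrite -fM !mulgV morph1. Qed.

Lemma morphX x n : f (x ^+ n) = f x ^+ n.
Proof. by elim: n => [|n IHn]; rewrite ?morph1 // !expgS fM IHn. Qed.

Lemma morphJ x y : f (x ^ y) = f x ^ f y.
Proof. by rewrite /conjg !fM morphV. Qed.

Lemma morphR x y : f [~ x, y] = [~ f x, f y].
Proof. by rewrite /commg fM morphV morphJ. Qed.

End GroupMorphisms.

Section Morphisms.
Variables (G H : topGroupType) (f : G -> H).
Hypothesis fM : {morph f : x y / x * y}.

Lemma preimage_subgroup (K : set H) : is_subgroup K -> is_subgroup (f @^-1` K).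
Proof.
case=> K1 KM KV; split=> [|x y|x] /=; first by rewrite (morph1 fM).
  by rewrite fM; exact: KM.
by rewrite (morphV fM); exact: KV.
Qed.

Lemma image_subgroup (K : set G) : is_subgroup K -> is_subgroup (f @` K).
Proof.
case=> K1 KM KV; split=> [|_ _ [x Kx <-] [y Ky <-]|_ [x Kx <-]].
- by exists 1 => //; exact: (morph1 fM).
- by exists (x * y); [exact: KM|exact: fM].
- by exists x^-1; [exact: KV|exact: (morphV fM)].
Qed.

Hypothesis fc : continuous f.

Lemma cgen_morph (S : set G) (K : set H) : is_subgroup K -> closed K ->
  (forall x, S x -> K (f x)) -> forall x, cgen S x -> K (f x).
Proof.
move=> gK cK SK; apply: cgen_min; [exact: preimage_subgroup| |exact: SK].
rewrite -openC preimage_setC; apply: open_comp; first by move=> ? _; exact: fc.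
exact: closed_openC.
Qed.

Lemma csubcomm_morph (A B : set G) (A' B' : set H) :
  (forall x, A x -> A' (f x)) -> (forall x, B x -> B' (f x)) ->
  forall x, csubcomm A B x -> csubcomm A' B' (f x).
Proof.
move=> AA' BB'; apply: cgen_morph; [exact: cgen_subgroup|exact: cgen_closed|].
move=> _ [x Ax [y By <-]]; rewrite (morphR fM); apply: sub_cgen.
by exists (f x); [exact: AA'|exists (f y) => //; exact: BB'].
Qed.

Lemma zassenhaus_rec_morph p k i x :
  zassenhaus_rec p k i x -> zassenhaus_rec p k i (f x).
Proof.
elim: k i x => [//|k IHk] i x /=; case: ifP => // _.
apply: cgen_morph; [exact: cgen_subgroup|exact: cgen_closed|].
move=> z [[y Dy <-]|[[j l] /= jl Dy]]; apply: sub_cgen.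
  by left; exists (f y); [exact: IHk|rewrite (morphX fM)].
by right; exists (j, l) => //=; apply: csubcomm_morph Dy => ?; exact: IHk.
Qed.

End Morphisms.

Lemma conjg_continuous (G : topGroupType) (g : G) :
  continuous (fun x : G => x ^ g).
Proof.
move=> x; rewrite /conjg.
pose h (y : G) := (g^-1, y * g) : G * G.
apply: (@continuous_comp _ _ _ h (fun xy : G * G => xy.1 * xy.2));
  last exact: mulg_continuous.
apply: cvg_pair; first exact: cvg_cst.
pose h' (y : G) := (y, g) : G * G.
apply: (@continuous_comp _ _ _ h' (fun xy : G * G => xy.1 * xy.2));
  last exact: mulg_continuous.
by apply: cvg_pair; [exact: cvg_id|exact: cvg_cst].
Qed.

(* Closed normal sigma-invariant subgroups: the ones whose quotient is again a
   Hausdorff sigma-group. *)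
Record sigmaNormal (G : sigmaGroupType) := SigmaNormal {
  sigma_normal_set :> set G;
  sigma_normal_subgroup : is_subgroup sigma_normal_set;
  sigma_normal_normal : is_normal sigma_normal_set;
  sigma_normal_closed : closed sigma_normal_set;
  sigma_normal_sigma : forall x, sigma_normal_set x -> sigma_normal_set (sigma x)
}.

Section Quotient.
Variables (G : sigmaGroupType) (N : sigmaNormal G).

Definition coset_rel : rel G := fun x y => `[< (sigma_normal_set N) (x^-1 * y) >].

Let N1 : (sigma_normal_set N) 1. Proof. by case: (sigma_normal_subgroup N). Qed.
Let NM x y : (sigma_normal_set N) x -> (sigma_normal_set N) y -> (sigma_normal_set N) (x * y).
Proof. by case: (sigma_normal_subgroup N) => _ + _; apply. Qed.
Let NV x : (sigma_normal_set N) x -> (sigma_normal_set N) x^-1.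
Proof. by case: (sigma_normal_subgroup N) => _ _; apply. Qed.
Let NJ x g : (sigma_normal_set N) x -> (sigma_normal_set N) (x ^ g). Proof. exact: sigma_normal_normal. Qed.

Let coset_refl : reflexive coset_rel.
Proof. by move=> x; apply/asboolP; rewrite mulVg. Qed.

Let coset_sym : symmetric coset_rel.
Proof.
by move=> x y; apply/asboolP/asboolP => /NV; rewrite invgM invgK.
Qed.

Let coset_trans : transitive coset_rel.
Proof.
move=> y x z /asboolP xy /asboolP yz; apply/asboolP.
by have := NM xy yz; rewrite mulgA mulgK.
Qed.

Canonical coset_equiv := EquivRel coset_rel coset_refl coset_sym coset_trans.

Definition squot := quotient_topology {eq_quot coset_equiv}%qT.

HB.instance Definition _ := Topological.on squot.
HB.instance Definition _ := Quotient.on squot.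

Definition squot_pi (x : G) : squot := (\pi_squot x)%qT.

Lemma squot_piP x y : squot_pi x = squot_pi y <-> (sigma_normal_set N) (x^-1 * y).
Proof.
split=> [/(eqmodP coset_equiv)/asboolP //|Nxy].
by apply/(eqmodP coset_equiv)/asboolP.
Qed.

Lemma squot_pi_surj (u : squot) : exists x, squot_pi x = u.
Proof. by exists (repr u); exact: reprK. Qed.

Lemma squot_reprP x : (sigma_normal_set N) ((repr (squot_pi x))^-1 * x).
Proof. by apply/squot_piP; exact: reprK. Qed.

Lemma squot_openE (U : set squot) : open U = open (squot_pi @^-1` U).
Proof. by []. Qed.

Lemma squot_pi_continuous : continuous squot_pi.
Proof. exact: pi_continuous. Qed.

Definition squot_mul (u v : squot) : squot := squot_pi (repr u * repr v).
Definition squot_inv (u : squot) : squot := squot_pi (repr u)^-1.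
Definition squot_sigma (u : squot) : squot := squot_pi (sigma (repr u)).

Lemma squot_mulE x y : squot_mul (squot_pi x) (squot_pi y) = squot_pi (x * y).
Proof.
apply/squot_piP; set a := repr _; set b := repr _.
have Na : (sigma_normal_set N) (a^-1 * x) := squot_reprP x.
have Nb : (sigma_normal_set N) (b^-1 * y) := squot_reprP y.
have := NM (NJ b Na) Nb.
by rewrite /conjg invgM !mulgA mulgK.
Qed.

Lemma squot_invE x : squot_inv (squot_pi x) = squot_pi x^-1.
Proof.
apply/squot_piP; set a := repr _; have Na : (sigma_normal_set N) (a^-1 * x) := squot_reprP x.
have := NJ a^-1 (NV Na).
by rewrite /conjg invgM !invgK !mulgA mulgK.
Qed.

Lemma squot_sigmaE x : squot_sigma (squot_pi x) = squot_pi (sigma x).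
Proof.
apply/squot_piP; set a := repr _; have Na : (sigma_normal_set N) (a^-1 * x) := squot_reprP x.
have := sigma_normal_sigma Na.
by rewrite sigmaM (morphV (@sigmaM G)).
Qed.

Let mulA : associative squot_mul.
Proof.
move=> u v w; case: (squot_pi_surj u) => x <-; case: (squot_pi_surj v) => y <-.
by case: (squot_pi_surj w) => z <-; rewrite !squot_mulE mulgA.
Qed.
Let mul1 : left_id (squot_pi 1) squot_mul.
Proof. by move=> u; case: (squot_pi_surj u) => x <-; rewrite squot_mulE mul1g. Qed.
Let mulx1 : right_id (squot_pi 1) squot_mul.
Proof. by move=> u; case: (squot_pi_surj u) => x <-; rewrite squot_mulE mulg1. Qed.
Let mulV : left_inverse (squot_pi 1) squot_inv squot_mul.
Proof.
by move=> u; case: (squot_pi_surj u) => x <-; rewrite squot_invE squot_mulE mulVg.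
Qed.
Let mulxV : right_inverse (squot_pi 1) squot_inv squot_mul.
Proof.
by move=> u; case: (squot_pi_surj u) => x <-; rewrite squot_invE squot_mulE mulgV.
Qed.

HB.instance Definition _ := isGroup.Build squot mulA mul1 mulx1 mulV mulxV.

Lemma squot_piM : {morph squot_pi : x y / x * y}.
Proof. by move=> x y; rewrite -squot_mulE. Qed.

Lemma squot_pi_open (U : set G) : open U -> open (squot_pi @` U).
Proof.
move=> oU; rewrite squot_openE.
have -> : squot_pi @^-1` (squot_pi @` U) =
    \bigcup_(h in (N : set G)) ((fun x => x * h) @^-1` U).
  apply/seteqP; split=> [x [y Uy /esym/squot_piP Nxy]|x [h Nh Uxh]].
    by exists (x^-1 * y) => //=; rewrite mulVKg.
  by exists (x * h) => //; apply/esym/squot_piP; rewrite mulKg.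
apply: bigcup_open => h _; apply: open_comp => // x _.
pose g (y : G) := (y, h) : G * G.
apply: (@continuous_comp _ _ _ g (fun xy : G * G => xy.1 * xy.2));
  last exact: mulg_continuous.
by apply: cvg_pair; [exact: cvg_id|exact: cvg_cst].
Qed.

Lemma squot_pi_nbhs x (U : set G) : nbhs x U -> nbhs (squot_pi x) (squot_pi @` U).
Proof.
rewrite nbhsE => -[V [oV Vx] VU]; exists (squot_pi @` V); split=> //.
- exact: squot_pi_open.
- exact: image_subset.
Qed.

Let mul_cont : continuous (fun xy : squot * squot => xy.1 * xy.2).
Proof.
move=> [u v] A /=; case: (squot_pi_surj u) => x <-; case: (squot_pi_surj v) => y <-.
rewrite -squot_piM => /squot_pi_continuous /= /(@mulg_continuous G (x, y)).
case=> -[B C] /= [nB nC] sBC.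
exists (squot_pi @` B, squot_pi @` C) => /=.
  by split; exact: squot_pi_nbhs.
move=> [_ _] /= [[b Bb <-] [c Cc <-]]; rewrite -squot_piM.
exact: (sBC (b, c)).
Qed.

Let inv_cont : continuous (fun x : squot => x^-1).
Proof.
move=> u; case: (squot_pi_surj u) => x <- A.
rewrite -(morphV squot_piM) => /squot_pi_continuous /= /(@invg_continuous G x) nA.
apply: filterS (squot_pi_nbhs nA) => _ [y Ay <-] /=.
by rewrite -(morphV squot_piM).
Qed.

HB.instance Definition _ := Group_isTopGroup.Build squot mul_cont inv_cont.

Let sigmaMq : {morph squot_sigma : x y / x * y}.
Proof.
move=> u v; case: (squot_pi_surj u) => x <-; case: (squot_pi_surj v) => y <-.
by rewrite -squot_piM !squot_sigmaE sigmaM squot_piM.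
Qed.
Let sigmaKq : involutive squot_sigma.
Proof. by move=> u; case: (squot_pi_surj u) => x <-; rewrite !squot_sigmaE sigmaK. Qed.
Let sigmaCq : continuous squot_sigma.
Proof.
move=> u; case: (squot_pi_surj u) => x <- A.
rewrite squot_sigmaE => /squot_pi_continuous /= /(@sigma_continuous G x) nA.
apply: filterS (squot_pi_nbhs nA) => _ [y Ay <-] /=.
by rewrite squot_sigmaE.
Qed.

HB.instance Definition _ := TopGroup_isSigmaGroup.Build squot sigmaMq sigmaKq sigmaCq.

End Quotient.

Definition is_sigma_hom (G H : sigmaGroupType) (f : G -> H) :=
  is_cmorph f /\ {morph f : x / sigma x}.

Definition sigma_iso (G H : sigmaGroupType) : Prop :=
  exists f : G -> H, exists g : H -> G,
    [/\ is_sigma_hom f, is_sigma_hom g, cancel f g & cancel g f].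

Lemma zassenhaus_normal p i (G : topGroupType) : is_normal (@zassenhaus G p i).
Proof.
move=> x g; apply: (@zassenhaus_rec_morph _ _ (fun x => x ^ g)); first by move=> ? ?; exact: conjMg.
exact: conjg_continuous.
Qed.

Lemma zassenhaus_sigma p i (G : sigmaGroupType) (x : G) :
  zassenhaus p i x -> zassenhaus p i (sigma x).
Proof. by apply: zassenhaus_rec_morph; [exact: sigmaM|exact: sigma_continuous]. Qed.

Definition zassenhaus_sn (p : nat) (G : sigmaGroupType) (i : nat) : sigmaNormal G :=
  SigmaNormal (@zassenhaus_rec_subgroup G p i i) (@zassenhaus_normal p i G)
    (@zassenhaus_rec_closed G p i i) (@zassenhaus_sigma p i G).

Definition zquot (p : nat) (G : sigmaGroupType) (i : nat) : sigmaGroupType :=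
  squot (zassenhaus_sn p G i).

Definition minus_set (G : sigmaGroupType) : set G := [set a | sigma a = a^-1].

(* G^- with its subspace topology and its Borel sigma-algebra *)
Definition minus_part (G : sigmaGroupType) : Type := set_type (@minus_set G).

Section Minus.
Variable G : sigmaGroupType.

Lemma minus_set1 : (1 : G) \in @minus_set G.
Proof. by apply/mem_set; rewrite /minus_set /= (morph1 (@sigmaM G)) invg1. Qed.

HB.instance Definition _ := Topological.on (minus_part G).
HB.instance Definition _ := isPointed.Build (minus_part G) (exist _ 1 minus_set1).
HB.instance Definition _ :=
  Measurable.copy (minus_part G) (g_sigma_algebraType (@open (minus_part G))).

Lemma minus_partP (a : minus_part G) : sigma (val a) = (val a)^-1.
Proof. exact: (set_mem (valP a)). Qed.

(* Open subgroups are closed, so N ranges over all sigma-invariant open normal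
   subgroups. *)
Definition is_haar (R : realType) (mu : probability (minus_part G) R) :=
  forall N : sigmaNormal G, open (sigma_normal_set N) ->
  forall b : squot N, minus_set b ->
    mu [set a : minus_part G | squot_pi N (val a) = b] =
    ((#|` fset_set (@minus_set (squot N))|%fset)%:R^-1)%R%:E.

End Minus.

Section Relators.
Variables (G : sigmaGroupType) (n : nat) (r : n.-tuple (minus_part G)).

Definition relator_conj : set G :=
  [set val (tnth r ig.1) ^ ig.2 | ig in [set: 'I_n * G]].

Lemma relator_normal : is_normal (cgen relator_conj).
Proof.
move=> x g; apply: (@cgen_morph _ _ (fun x => x ^ g)); first by move=> ? ?; exact: conjMg.
- exact: conjg_continuous.
- exact: cgen_subgroup.
- exact: cgen_closed.
by move=> _ [[i h] _ <-]; apply: sub_cgen; exists (i, h * g); rewrite //= conjgM.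
Qed.

Lemma relator_sigma x : cgen relator_conj x -> cgen relator_conj (sigma x).
Proof.
apply: cgen_morph; [exact: sigmaM|exact: sigma_continuous|exact: cgen_subgroup|
  exact: cgen_closed|].
move=> _ [[i h] _ <-] /=; rewrite (morphJ (@sigmaM G)) minus_partP conjVg.
case: (cgen_subgroup relator_conj) => _ _; apply; apply: sub_cgen.
by exists (i, sigma h).
Qed.

Definition relator_sn : sigmaNormal G :=
  SigmaNormal (cgen_subgroup _) relator_normal (@cgen_closed _ _) relator_sigma.

Definition presented : sigmaGroupType := squot relator_sn.

End Relators.

(* H^1(G, F_p) for the trivial action: continuous homomorphisms to the discrete
   group F_p. *)
Definition H1_Fp (p : nat) (G : topGroupType) : set (G -> 'F_p) :=
  [set f | {morph f : x y / (x * y)%g >-> (x + y)%R} /\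
           forall a, open (f @^-1` [set a])].

(* dim H^1(G, F_p) = m, by existence of a basis with m elements *)
Definition H1_dim (p : nat) (G : topGroupType) (m : nat) : Prop :=
  exists b : 'I_m -> G -> 'F_p, (forall i, H1_Fp (b i)) /\
    forall f, H1_Fp f -> exists! c : {ffun 'I_m -> 'F_p},
      forall x, f x = (\sum_(i < m) c i * b i x)%R.

Definition is_free_pro_p (p n : nat) (F : topGroupType) (x : 'I_n -> F) : Prop :=
  is_pro_p F p /\
  forall (H : topGroupType) (h : 'I_n -> H), is_pro_p H p ->
    exists! f : F -> H, is_cmorph f /\ forall i, f (x i) = h i.

Record freeSigma (p n : nat) := FreeSigma {
  free_group :> sigmaGroupType;
  free_gen : 'I_n -> free_group;
  free_genP : is_free_pro_p p free_gen;
  sigma_free_gen : forall i, sigma (free_gen i) = (free_gen i)^-1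
}.

Section SigmaIso.
Implicit Types G H K : sigmaGroupType.

Lemma is_sigma_hom_comp G H K (f : G -> H) (g : H -> K) :
  is_sigma_hom f -> is_sigma_hom g -> is_sigma_hom (g \o f).
Proof.
case=> [[fc fM] fs] [[gc gM] gs]; split; first split.
- by move=> x; apply: continuous_comp; [exact: fc|exact: gc].
- by move=> x y /=; rewrite fM gM.
- by move=> x /=; rewrite fs gs.
Qed.

Lemma squot_pi_hom G (N : sigmaNormal G) : is_sigma_hom (squot_pi N).
Proof.
split; first by split; [exact: squot_pi_continuous|exact: squot_piM].
by move=> x; rewrite -squot_sigmaE.
Qed.

Lemma sigma_iso_refl G : sigma_iso G G.
Proof.
have h : is_sigma_hom (@id G) by split=> //; split=> // x; exact: cvg_id.
by exists id, id.
Qed.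

Lemma sigma_iso_sym G H : sigma_iso G H -> sigma_iso H G.
Proof. by case=> f [g [fh gh fK gK]]; exists g, f. Qed.

Lemma sigma_iso_trans G H K : sigma_iso G H -> sigma_iso H K -> sigma_iso G K.
Proof.
case=> f [f' [fh fh' fK fK']] [g [g' [gh gh' gK gK']]].
exists (g \o f), (f' \o g'); split; try exact: is_sigma_hom_comp.
  by move=> x /=; rewrite gK fK.
by move=> x /=; rewrite fK' gK'.
Qed.

Lemma squot_lift G H (N : sigmaNormal G) (f : G -> H) :
  is_sigma_hom f -> (forall x, sigma_normal_set N x -> f x = 1) ->
  exists2 g : squot N -> H, is_sigma_hom g & forall x, g (squot_pi N x) = f x.
Proof.
case=> [[fc fM] fs] fN; pose g (u : squot N) := f (repr u).
have gE x : g (squot_pi N x) = f x.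
  apply: (mulgI (f (repr (squot_pi N x)))^-1).
  by rewrite mulVg -(morphV fM) -fM fN //; exact: squot_reprP.
exists g => //; split; first split.
- have gc : continuous (g \o squot_pi N).
    have -> : g \o squot_pi N = f by apply: funext => x; exact: gE.
    exact: fc.
  exact/quotient_continuous.
- move=> u v; case: (squot_pi_surj u) => x <-; case: (squot_pi_surj v) => y <-.
  by rewrite -squot_piM !gE fM.
- move=> u; case: (squot_pi_surj u) => x <-.
  by rewrite -(squot_pi_hom N).2 !gE fs.
Qed.

Lemma squot_iso G H (N : sigmaNormal G) (M : sigmaNormal H)
    (f : G -> squot M) (g : H -> squot N) :
  is_sigma_hom f -> is_sigma_hom g ->
  (forall x, sigma_normal_set N x -> f x = 1) ->
  (forall y, sigma_normal_set M y -> g y = 1) ->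
  (forall x y, f x = squot_pi M y <-> g y = squot_pi N x) ->
  sigma_iso (squot N) (squot M).
Proof.
move=> fh gh /(squot_lift fh)[f' fh' fE] /(squot_lift gh)[g' gh' gE] fg.
exists f', g'; split=> // u.
  case: (squot_pi_surj u) => x <-; case: (squot_pi_surj (f x)) => y fx.
  by rewrite fE -fx gE; apply/fg.
case: (squot_pi_surj u) => y <-; case: (squot_pi_surj (g y)) => x gy.
by rewrite gE -gy fE; apply/fg.
Qed.

Lemma squot_pi1 G (N : sigmaNormal G) x :
  squot_pi N x = 1 <-> sigma_normal_set N x.
Proof.
split=> [/esym|Nx]; first by move=> /(squot_piP N); rewrite invg1 mul1g.
by apply/esym; apply/(squot_piP N); rewrite invg1 mul1g.
Qed.

Lemma zquot_iso p i G H : sigma_iso G H -> sigma_iso (zquot p G i) (zquot p H i).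
Proof.
case=> f [g [fh gh fK gK]].
have fD x : zassenhaus p i x -> zassenhaus p i (f x).
  by case: fh => -[fc fM] _; exact: zassenhaus_rec_morph.
have gD x : zassenhaus p i x -> zassenhaus p i (g x).
  by case: gh => -[gc gM] _; exact: zassenhaus_rec_morph.
case: (fh) (gh) => -[_ fM] _ [[_ gM] _].
apply: (@squot_iso _ _ _ _ (squot_pi _ \o f) (squot_pi _ \o g)).
- exact: is_sigma_hom_comp (squot_pi_hom _).
- exact: is_sigma_hom_comp (squot_pi_hom _).
- by move=> x Dx; apply/squot_pi1; exact: fD.
- by move=> x Dx; apply/squot_pi1; exact: gD.
move=> x y; split=> [/squot_piP /gD|/squot_piP /fD] /=.
  by rewrite gM (morphV gM) fK => h; apply/esym/squot_piP.
by rewrite fM (morphV fM) gK => h; apply/esym/squot_piP.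
Qed.

Lemma squot_zassenhaus_rec p k i G (N : sigmaNormal G) :
  sigma_normal_set N `<=` zassenhaus_rec p k i ->
  forall x, zassenhaus_rec p k i (squot_pi N x) -> zassenhaus_rec p k i x.
Proof.
move=> sN x.
suff im u : zassenhaus_rec p k i u ->
    exists2 y, zassenhaus_rec p k i y & squot_pi N y = u.
  case/im => y Dy /squot_piP /sN Dyx; rewrite -(mulVKg y x).
  by case: (@zassenhaus_rec_subgroup G p k i) => _ + _; apply.
elim: k i sN u {x} => [|k IHk] i sN u /=.
  by move=> _; case: (squot_pi_surj u) => y <-; exists y.
case: ifP => [_ _|i1]; first by case: (squot_pi_surj u) => y <-; exists y.
set S := (X in cgen X u -> _).
pose T : set G := [set x ^+ p | x in zassenhaus_rec p k ((i + p.-1) %/ p)] `|`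
  \bigcup_(jl in [set jl : nat * nat |
                   [/\ 0 < jl.1, 0 < jl.2 & jl.1 + jl.2 = i]%N])
    csubcomm (zassenhaus_rec p k jl.1) (zassenhaus_rec p k jl.2).
change (cgen S u -> exists2 y, cgen T y & squot_pi N y = u).
have sNT : sigma_normal_set N `<=` cgen T by move: sN; rewrite /= i1.
have sNk j : (j <= i)%N -> sigma_normal_set N `<=` zassenhaus_rec p k j.
  by move=> ji x /sN; exact: zassenhaus_recS.
have [T1 TM TV] := cgen_subgroup T.
have gK : is_subgroup (squot_pi N @` cgen T).
  by apply: image_subgroup; [exact: squot_piM|exact: cgen_subgroup].
have cK : closed (squot_pi N @` cgen T).
  rewrite -openC squot_openE -preimage_setC.
  have -> : squot_pi N @^-1` (squot_pi N @` cgen T) = cgen T.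
    apply/seteqP; split=> [x [y Ty /squot_piP/sNT Tyx]|x Tx]; last by exists x.
    by rewrite -(mulVKg y x); exact: TM.
  by apply: closed_openC; exact: cgen_closed.
suff : cgen S `<=` squot_pi N @` cgen T by move=> h /h [y]; exists y.
apply: cgen_min => // z [[v Dv <-]|[[j l] /= [j0 l0 jl] Dz]].
  have [|y Dy <-] := IHk _ _ _ Dv.
    apply: sNk; case: (p) => [|q]; first by rewrite divn0.
    by rewrite -ltnS ltn_divLR; nia.
  exists (y ^+ p); last by rewrite (morphX (@squot_piM _ N)).
  by apply: sub_cgen; left; exists y.
have sTN : csubcomm (zassenhaus_rec p k j) (zassenhaus_rec p k l) `<=` cgen T.
  by move=> w Dw; apply: sub_cgen; right; exists (j, l).
suff : csubcomm (zassenhaus_rec p k j) (zassenhaus_rec p k l) `<=`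
  squot_pi N @` cgen T by apply.
apply: cgen_min => // _ [a Da [b Db <-]].
have [|y Dy <-] := IHk _ _ _ Da; first by apply: sNk; lia.
have [|w Dw <-] := IHk _ _ _ Db; first by apply: sNk; lia.
rewrite -(morphR (@squot_piM _ N)); exists [~ y, w] => //.
by apply: sTN; apply: sub_cgen; exists y => //; exists w.
Qed.

Lemma zquot_zquot p i j G : (i <= j)%N ->
  sigma_iso (zquot p (zquot p G j) i) (zquot p G i).
Proof.
move=> ij; have sD : sigma_normal_set (zassenhaus_sn p G j) `<=`
  sigma_normal_set (zassenhaus_sn p G i) by exact: zassenhaus_recS.
have [f fh fE] : exists2 f : zquot p G j -> zquot p G i,
    is_sigma_hom f & forall x, f (squot_pi _ x) = squot_pi _ x.
  by apply: squot_lift; [exact: squot_pi_hom|move=> x /sD/squot_pi1].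
have DE x : zassenhaus p i (squot_pi (zassenhaus_sn p G j) x) <->
    zassenhaus p i x.
  split; first exact: squot_zassenhaus_rec.
  by apply: zassenhaus_rec_morph; [exact: squot_piM|exact: squot_pi_continuous].
apply: (@squot_iso _ _ _ _ f (squot_pi _ \o squot_pi _)) => //.
- by apply: is_sigma_hom_comp; exact: squot_pi_hom.
- move=> u; case: (squot_pi_surj u) => x <- /DE Dx.
  by rewrite fE; apply/squot_pi1.
- by move=> x /DE Dx; apply/squot_pi1.
move=> u y; case: (squot_pi_surj u) => x <-; rewrite fE /=; split.
  move=> /squot_piP /DE; rewrite squot_piM (morphV (@squot_piM _ _)) => h.
  exact/esym/squot_piP.
move=> /esym/squot_piP h; apply/squot_piP/DE.
by rewrite squot_piM (morphV (@squot_piM _ _)).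
Qed.

Lemma zquot_isoS p i j G H : (i <= j)%N ->
  sigma_iso (zquot p G j) (zquot p H j) -> sigma_iso (zquot p G i) (zquot p H i).
Proof.
move=> ij /(@zquot_iso p i) GH.
apply: sigma_iso_trans (sigma_iso_sym (zquot_zquot p G ij)) _.
exact: sigma_iso_trans GH (zquot_zquot p H ij).
Qed.

End SigmaIso.

Lemma squot_preimage_subgroup (G : sigmaGroupType) (N : sigmaNormal G)
  (H : set (squot N)) : is_subgroup H -> is_subgroup (squot_pi N @^-1` H).
Proof. by apply: preimage_subgroup; exact: squot_piM. Qed.

Lemma is_pro_p_squot (p : nat) (G : sigmaGroupType) (N : sigmaNormal G) :
  is_pro_p G p -> is_pro_p (squot N) p.
Proof.
have piT : squot_pi N @` [set: G] = [set: squot N].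
  by apply/seteqP; split=> // u _; have [x <-] := squot_pi_surj u; exists x.
have [piC piM] := (squot_pi_hom N).1.
case=> -[Gc Gh Gb] Gi; split; first split.
- rewrite -piT; apply: continuous_compact => //.
  exact: continuous_subspaceT.
- rewrite open_hausdorff => u v; case: (squot_pi_surj u) => x <-.
  case: (squot_pi_surj v) => y <- xy.
  have Nxy : (~` (sigma_normal_set N)) (x^-1 * y).
    by move=> /squot_piP; exact/eqP.
  pose g (z : G * G) := (z.1^-1, z.2) : G * G.
  have gc : continuous g.
    move=> z; apply: cvg_pair; last exact: cvg_snd.
    apply: (@continuous_comp _ _ _ fst (fun x : G => x^-1)); first exact: cvg_fst.
    exact: invg_continuous.
  have : nbhs (x, y) ((fun z : G * G => z.1^-1 * z.2) @^-1` (~` (sigma_normal_set N))).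
    have := open_nbhs_nbhs (conj (closed_openC (@sigma_normal_closed G N)) Nxy).
    exact: (@continuous_comp _ _ _ g (fun z : G * G => z.1 * z.2) (x, y)
      (gc (x, y)) (@mulg_continuous G (g (x, y)))).
  case=> -[A B] /= [nA nB] AB.
  move: nA nB; rewrite !nbhsE => -[A' [oA A'x] sA] [B' [oB B'y] sB].
  exists (squot_pi N @` A', squot_pi N @` B') => /=.
    by split; apply/mem_set; [exists x|exists y].
  split; [exact: squot_pi_open|exact: squot_pi_open|].
  apply/eqP/seteqP; split=> // w [[a Aa <-] [b Bb /esym/squot_piP]].
  exact: (AB (a, b) (conj (sA _ Aa) (sB _ Bb))).
- move=> U nU; have [|H [gH oH HU]] := Gb (squot_pi N @^-1` U).
    by apply: piC; rewrite (morph1 piM).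
  exists (squot_pi N @` H); split; [exact: image_subgroup|exact: squot_pi_open|].
  by move=> _ [x Hx <-]; exact: HU.
move=> H gH nH oH; have gH' := squot_preimage_subgroup gH.
have [||k Hk] := Gi (squot_pi N @^-1` H) gH'.
- by move=> x g Hx /=; rewrite (morphJ piM); exact: nH.
- by apply: open_comp; [move=> x _; exact: piC|exact: oH].
exists k; apply: card_eq_trans Hk.
have cosetE x : squot_pi N @^-1` [set squot_pi N x * h | h in H] =
    [set x * h | h in squot_pi N @^-1` H].
  apply/seteqP; split=> [y [h Hh hy]|_ [h Hh <-] /=].
    exists (x^-1 * y); last by rewrite mulVKg.
    by rewrite /= piM (morphV piM) -hy mulKg.
  by exists (squot_pi N h) => //; rewrite piM.
have -> : lcoset_set (squot_pi N @^-1` H) =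
    [set squot_pi N @^-1` K | K in lcoset_set H].
  apply/seteqP; split=> [_ [x _ <-]|_ [_ [u _ <-] <-]].
    exists [set squot_pi N x * h | h in H]; last exact: cosetE.
    by exists (squot_pi N x).
  by have [x <-] := squot_pi_surj u; exists x => //; rewrite cosetE.
rewrite card_eq_sym; apply: inj_card_eq => K L _ _ KL.
apply/seteqP; split=> u; have [x <-] := squot_pi_surj u.
  by rewrite -[X in X -> _]/((squot_pi N @^-1` K) x) KL.
by rewrite -[X in X -> _]/((squot_pi N @^-1` L) x) -KL.
Qed.

Section Sch.
Variables (p : nat) (F : forall n, freeSigma p n).
Implicit Types G H K : sigmaGroupType.

(* A tuple of relators r in (F_n^-)^n, together with n; Gr is G_r. *)
Definition presentation : Type := {n : nat & n.-tuple (minus_part (F n))}.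

Definition Gr (x : presentation) : sigmaGroupType := presented (tagged x).

Definition weak_schur G : Prop :=
  is_pro_p G p /\ exists x : presentation, sigma_iso G (Gr x).

(* The class [G] is encoded by the set of all (n, r) with G_r isomorphic to G,
   which determines G up to isomorphism (Sch_classP); the sigma-isomorphism
   class itself would live in a larger universe. *)
Definition iso_class G : set presentation := [set x | sigma_iso G (Gr x)].

Definition Sch : Type :=
  set_type [set C : set presentation | exists2 G, weak_schur G & C = iso_class G].

Lemma Gr_weak_schur x : weak_schur (Gr x).
Proof.
split; last by exists x; exact: sigma_iso_refl.
by apply: is_pro_p_squot; case: (free_genP (F (tag x))).
Qed.

Definition Sch_class G (hG : weak_schur G) : Sch :=
  exist _ (iso_class G) (mem_set (ex_intro2 _ _ G hG erefl)).

Lemma Sch_classP G H (hG : weak_schur G) (hH : weak_schur H) :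
  Sch_class hG = Sch_class hH <-> sigma_iso G H.
Proof.
split=> [[GH]|GH]; last first.
  apply: val_inj => /=; apply/seteqP; split=> x /=; apply: sigma_iso_trans => //.
  exact: sigma_iso_sym.
case: (hH) => _ [x Hx]; apply: sigma_iso_trans (sigma_iso_sym Hx).
by have : iso_class H x by []; rewrite -GH.
Qed.

Lemma Sch_class_surj (c : Sch) : exists G (hG : weak_schur G), c = Sch_class hG.
Proof.
case: (set_mem (valP c)) => G hG cG; exists G, hG; exact: val_inj.
Qed.

Definition Sch_m (m : nat) : set Sch :=
  [set c | exists G (hG : weak_schur G), c = Sch_class hG /\ H1_dim p G m].

Definition Sch_basic (i : nat) G : set Sch :=
  [set c | exists H (hH : weak_schur H),
     c = Sch_class hH /\ sigma_iso (zquot p H i) (zquot p G i)].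

Definition Sch_basis : set (set Sch) :=
  [set U | exists i G, [/\ (2 <= i)%N, weak_schur G & U = Sch_basic i G]].

Lemma Sch_basis_cover : \bigcup_(U in Sch_basis) U = setT.
Proof.
apply/seteqP; split=> // c _; have [G [hG cG]] := Sch_class_surj c.
exists (Sch_basic 2 G); first by exists 2, G.
by exists G, hG; split=> //; exact: sigma_iso_refl.
Qed.

Lemma Sch_basis_join (U V : set Sch) c : Sch_basis U -> Sch_basis V ->
  U c -> V c -> exists W, [/\ Sch_basis W, W c & W `<=` U `&` V].
Proof.
move=> [i [G [i2 hG ->]]] [j [H [j2 hH ->]]] [K [hK [-> KG]]].
move=> [L [hL [/Sch_classP KL LH]]].
exists (Sch_basic (maxn i j) K); split.
- by exists (maxn i j), K; split=> //; rewrite leq_max i2.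
- by exists K, hK; split=> //; exact: sigma_iso_refl.
move=> _ [M [hM [-> MK]]]; split; exists M, hM; split=> //.
  apply: sigma_iso_trans KG; apply: zquot_isoS MK; exact: leq_maxl.
apply: sigma_iso_trans LH; apply: sigma_iso_trans (zquot_iso p j KL).
by apply: zquot_isoS MK; exact: leq_maxr.
Qed.

(* The topology on Sch has the sets U_{i,G} as a basis; Sch is measurable with
   the associated Borel sigma-algebra. *)
HB.instance Definition _ := Choice.on Sch.
HB.instance Definition _ :=
  isBaseTopological.Build Sch Sch_basis_cover Sch_basis_join.
HB.instance Definition _ :=
  isPointed.Build Sch (Sch_class (Gr_weak_schur (existT _ 0 [tuple]))).
HB.instance Definition _ :=
  Measurable.copy Sch (g_sigma_algebraType (@open Sch)).

Definition Sch_of (n : nat) (r : n.-tuple (minus_part (F n))) : Sch :=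
  Sch_class (Gr_weak_schur (existT _ n r)).

Definition Sch_mu (R : realType) (n : nat)
    (mut : probability (n.-tuple (minus_part (F n))) R) : set Sch -> \bar R :=
  pushforward mut (@Sch_of n).

End Sch.

Arguments Sch_m {p} F m.
Arguments Sch_basic {p} F i G.
Arguments Sch_basis {p} F.

Definition is_product_measure (R : realType) d (T : measurableType d) (n : nat)
    (P : probability T R) (Q : probability (n.-tuple T) R) : Prop :=
  forall A : 'I_n -> set T, (forall i, measurable (A i)) ->
    Q [set t | forall i, A i (tnth t i)] = (\prod_(i < n) P (A i))%E.

Definition Cprod (R : realType) (p k : nat) : R :=
  (\prod_(1 <= i < k.+1) (1 - p%:R ^- i))%R.

(* Main.v *)
(* Passing from n to n + 1, it is enough to show that on a set of classes [G]
   with d_G = m, the mass is multiplied by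
   (1 - p^-(n+1))^2 / (1 - p^-(n+1-m)).  Put N = n + 1.  Modulo D_2 a tuple of
   N relators of F_N is an N x N matrix M over F_p, and d_G = m says that M has
   corank m.
   - Exactly p^N - p^m row vectors v satisfy v M <> 0.  If v_k <> 0, an
     invertible row operation which does not change the presented group turns
     the condition v M <> 0 into the condition that the k-th row of M is
     nonzero.  Hence
     (p^N - p^m) mass(all) = (p^N - 1) mass(k-th relator not in D_2).
   - A relator y in F_N^- outside D_2 is part of a basis of F_N contained in
     F_N^-, so that F_N / <<y>> is F_n, with Haar measure going to Haar
     measure.  Hence the mass of the tuples whose k-th relator is not in D_2
     is (1 - p^-N) times the mass for n.
   All this is counted in the finite groups F_N / D_i(F_N), which gives the
   equality on the sets which are unions of classes modulo D_i.  An open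
   subset of Sch is an increasing union of such sets, so the two measures agree
   on open sets and therefore everywhere. *)
Require Import Defs.
From HB Require Import structures.
From mathcomp Require Import all_boot all_order all_algebra zify finmap.
From mathcomp Require fingroup pgroup maximal commutator abelian.
From mathcomp Require Import all_classical all_reals all_analysis.

Set Implicit Arguments.
Unset Strict Implicit.
Unset Printing Implicit Defensive.

Import Order.TTheory GRing.Theory Num.Theory.

Local Open Scope classical_set_scope.

(** * Uniformly distributed maps to finite sets *)

(** The relators have to stay in [F_n^-], which in general is not a subgroup, so rows of the matrix
    cannot simply be added. Twisted conjugation [r -> w r sigma(w)^-1] does act on [F_n^-]. Modulo
    D_2, where sigma is -1, it adds twice the class of [w] to that of [r], and as [p] is odd every
    multiple is available. The presented group is unchanged when [w] lies in the normal closure of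
    the other relators.

    [F_n] is known only through its universal property. Topological generation, openness of the D_i
    (hence finiteness of the levels), coordinates modulo D_2 and the change of basis all have to be
    drawn from existence and uniqueness of homomorphisms. A Frattini argument gives surjectivity of
    the change of basis, and the Hopf property its injectivity.

    At each level the measures are normalised counting measures, so the identities are between
    natural numbers. With P = p^N they amount to mass_N (P - p^m) P = (P - 1)^2 mass_(N-1). One
    factor P - 1 counts the non-zero [v], the other the non-zero coordinate vectors of the
    eliminated relator. *)

Section Uniform.
Variables (R : realType) (d : measure_display) (T : measurableType d).
Variable P : probability T R.

Definition uniform_map (Q : finType) (c : T -> Q) :=
  (forall q, measurable (c @^-1` [set q])) /\
  (forall q, P (c @^-1` [set q]) = (#|Q|%:R^-1)%:E).

Lemma measure_preimage_finType (d' : measure_display) (T' : measurableType d')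
    (P' : probability T' R) (Q : finType) (c : T' -> Q) (x : R) (S : {set Q}) :
  (forall q, measurable (c @^-1` [set q])) ->
  (forall q, q \in S -> P' (c @^-1` [set q]) = x%:E) ->
  measurable [set t | c t \in S] /\
  P' [set t | c t \in S] = (#|S|%:R * x)%:E.
Proof.
move=> cm cx; have -> : [set t | c t \in S] =
    \bigcup_(q in [set` enum S]) (c @^-1` [set q]).
  apply/seteqP; split=> [t /= ct|t [q /=]]; last by rewrite mem_enum => qS ->.
  by exists (c t) => //=; rewrite mem_enum.
split; first by apply: fin_bigcup_measurable => //; exact: finite_seq.
have tS : trivIset [set` enum S] (fun q => c @^-1` [set q]).
  by move=> q q' _ _ [t [/= <- <-]].
rewrite measure_fin_bigcup //.
rewrite -fsbig_seq ?enum_uniq //=.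
rewrite (eq_big_seq (fun=> x%:E)) => [|q]; last by rewrite mem_enum => /cx.
by rewrite sumEFin big_const_seq count_predT -cardE iter_addr_0 mulr_natl.
Qed.

Lemma uniform_map_card (Q : finType) (c : T -> Q) (S : {set Q}) : uniform_map c ->
  P [set t | c t \in S] = (#|S|%:R / #|Q|%:R)%:E.
Proof. by case=> cm cQ; rewrite (measure_preimage_finType cm (fun q _ => cQ q)).2. Qed.

(** By the product formula every tuple of values has mass [#|Q|^-n]. This is the only use made of
    the product measure. *)
Lemma uniform_tuple n (Pn : probability (n.-tuple T) R) (Q : finType) (c : T -> Q)
    (S : {set {ffun 'I_n -> Q}}) :
  is_product_measure P Pn -> uniform_map c ->
  measurable [set t : n.-tuple T | [ffun i => c (tnth t i)] \in S] /\
  Pn [set t : n.-tuple T | [ffun i => c (tnth t i)] \in S] =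
    (#|S|%:R / (#|Q| ^ n)%:R)%:E.
Proof.
move=> PnP [cm cQ].
have cE q : (fun t : n.-tuple T => [ffun i => c (tnth t i)]) @^-1` [set q] =
    [set t | forall i, (c @^-1` [set q i]) (tnth t i)].
  apply/seteqP; split=> t /=; first by move=> /ffunP h i; rewrite -h ffunE.
  by move=> h; apply/ffunP => i; rewrite ffunE; exact: h.
apply: measure_preimage_finType => q; rewrite cE.
  have -> : [set t | forall i, (c @^-1` [set q i]) (tnth t i)] =
      \bigcap_(i in [set: 'I_n])
        ((fun t : n.-tuple T => tnth t i) @^-1` (c @^-1` [set q i])).
    by apply/seteqP; split=> t h i; [move=> _|]; exact: h.
  apply: fin_bigcap_measurable; first exact: finite_finset.
  by move=> i _; rewrite -[X in measurable X]setTI; exact: measurable_tnth.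
move=> _; rewrite (PnP (fun i => c @^-1` [set q i])) //; under eq_bigr do rewrite cQ.
rewrite prodEFin prodr_const card_ord natrX exprVn.
by [].
Qed.

(** Equal masses mean equal cardinalities, and the fibres of [f] partition [Q]. Equidistribution
    thus becomes an identity of natural numbers. *)
Lemma uniform_fiber_card (Q B : finType) (c : T -> Q) (f : Q -> B) (x : \bar R) :
  uniform_map c -> (forall b, P [set t | f (c t) = b] = x) ->
  forall b, (#|f @^-1: [set b]%SET| * #|B| = #|Q|)%N.
Proof.
move=> cu fx.
have fE b : P [set t | f (c t) = b] = (#|f @^-1: [set b]%SET|%:R / #|Q|%:R)%:E.
  rewrite -(uniform_map_card _ cu); congr (P _).
  by apply/seteqP; split=> t /=; rewrite !finset.inE => /eqP.
have eqf b b' : #|f @^-1: [set b]%SET| = #|f @^-1: [set b']%SET|.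
  have := fx b; rewrite -(fx b') !fE => -[].
  have [Q0|Q0] := posnP #|Q|.
    have c0 (S : {set Q}) : #|S| = 0%N by apply/eqP; rewrite -leqn0 -Q0 max_card.
    by rewrite !c0.
  move=> /(mulIf _) h; apply/eqP; rewrite -(eqr_nat R); apply/eqP; apply: h.
  by rewrite invr_eq0 pnatr_eq0 -lt0n.
move=> b; rewrite -(cardsT Q).
have -> : #|[set: Q]%SET| = (\sum_(b' : B) #|f @^-1: [set b']%SET|)%N.
  rewrite -sum1_card (partition_big f predT) //=; apply: eq_bigr => b' _.
  by rewrite -sum1_card; apply: eq_bigl => q; rewrite !finset.inE.
by rewrite (eq_bigr (fun=> #|f @^-1: [set b]%SET|)) // sum_nat_const mulnC.
Qed.

End Uniform.

Local Open Scope group_scope.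

(** * Topological groups and the Frattini argument *)

Module FinitePGroup.
Import fingroup pgroup maximal commutator abelian.

(** [Phi] is the Frattini subgroup: for a finite p-group it is generated by the commutators and the
    p-th powers, and its elements are non-generators. The carrier of [G] is equipped with a
    [finGroupType] structure inside the proof only, so that the statement speaks of plain sets. *)
Lemma finite_p_group_frattini (p k : nat) (G : topGroupType) : prime p ->
  ([set: G] #= `I_(p ^ k)%N)%card ->
  exists Phi : set G, [/\ is_subgroup Phi, forall x, Phi (x ^+ p),
    forall x y, Phi [~ x, y] &
    forall H, is_subgroup H ->
      (forall g, exists2 h, H h & Phi (h^-1 * g)) -> H = setT].
Proof.
move=> p_pr cG.
have finG : finite_set [set: G] by exists (p ^ k)%N.
pose s : seq G := fset_set [set: G].
have us : uniq s by exact: fset_uniq.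
have ms x : x \in s by rewrite in_fset_set //; exact/mem_set.
have sa : Finite.axiom s by move=> x; rewrite count_uniq_mem // ms.
have sK : pcancel (index^~ s) (onth s).
  by move=> x; rewrite onthE (nth_map x) ?index_mem ?nth_index ?size_map.
pose gT : finGroupType := HB.pack_for finGroupType (TopGroup.sort G)
  (isCountable.Build (TopGroup.sort G) sK)
  (fintype.isFinite.Build (TopGroup.sort G) sa).
have cgT : #|[set: gT]%SET| = (p ^ k)%N.
  rewrite cardsT -(card_fset_set cG) -[RHS](@card_uniqP gT s us).
  by apply: eq_card => x; rewrite inE; exact/esym/ms.
have pP : p.-group [set: gT]%SET.
  by rewrite /pgroup.pgroup cgT pnatX pnat_id.
have PhiE := Phi_joing pP.
exists [set x : G | (x : gT) \in 'Phi([set: gT]%G)].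
split=> [|x|x y|H gH HPhi] /=.
- split=> [|x y|x] /=; first exact: group1.
  + exact: groupM.
  + exact: groupVr.
- have hx : (x : gT) ^+ (p ^ 1)%N \in 'Mho^1([set: gT]%G).
    by apply: Mho_p_elt; [exact: finset.in_setT|exact: (mem_p_elt pP (finset.in_setT _))].
  rewrite expn1 in hx; rewrite PhiE.

  exact: (fintype.subsetP (joing_subr ([set: gT]%G)^`(1)%g 'Mho^1([set: gT]%G)) _ hx).
- have hxy : [~ (x : gT), y] \in ([set: gT]%G)^`(1).
    by apply: mem_commg; exact: finset.in_setT.
  rewrite PhiE.
  exact: (fintype.subsetP (joing_subl ([set: gT]%G)^`(1)%g 'Mho^1([set: gT]%G)) _ hxy).
pose K : {set gT} := [set x : gT | `[< H x >]]%SET.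
have [H1 HM HV] := gH.
have KE x : (x \in K) = `[< H x >] by rewrite finset.inE.
have gK : group_set K.
  apply/group_setP; split; first by rewrite KE; exact/asboolP.
  by move=> x y; rewrite !KE => /asboolP Hx /asboolP Hy; apply/asboolP/(HM x y).
have KT : K = [set: gT]%SET.
  have := @Phi_nongen _ [set: gT]%G K; rewrite (genGid (Group gK)); apply.
  apply/eqP; rewrite finset.eqEsubset finset.subsetT /=; apply/fintype.subsetP => g _.
  have [h Hh hg] := HPhi g.
  have hK : (h : gT) \in K by rewrite KE; apply/asboolP; exact: Hh.
  have hJ := fintype.subsetP (joing_subr 'Phi([set: gT]%G) K) _ hK.
  have := groupM hJ (fintype.subsetP (joing_subl 'Phi([set: gT]%G) K) _ hg).
  by rewrite (mulVKg (h : gT)).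
apply/seteqP; split=> // g _.
have : (g : gT) \in K by rewrite KT finset.in_setT.
by rewrite KE => /asboolP.
Qed.

End FinitePGroup.

Section TopGroup.
Variable G : topGroupType.
Implicit Types (H K : set G).

Lemma mulgl_continuous (h : G) : continuous (fun x : G => h * x).
Proof.
move=> x; pose g (y : G) := (h, y) : G * G.
apply: (@continuous_comp _ _ _ g (fun xy : G * G => xy.1 * xy.2));
  last exact: mulg_continuous.
by apply: cvg_pair; [exact: cvg_cst|exact: cvg_id].
Qed.

Lemma subgroup_nbhs_open H : is_subgroup H -> nbhs 1 H -> open H.
Proof.
move=> [H1 HM HV] nH; rewrite openE => x Hx.
have : nbhs x ((fun y => x^-1 * y) @^-1` H).
  by apply: mulgl_continuous; rewrite mulVg.
by apply: filterS => y /= Hy; rewrite -(mulVKg x y); exact: HM.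
Qed.

Lemma open_subgroup_closed H : is_subgroup H -> open H -> closed H.
Proof.
move=> [H1 HM HV] oH; rewrite -[H]setCK; apply: open_closedC.
rewrite openE => x nHx.
have : nbhs x ((fun y => x^-1 * y) @^-1` H).
  by apply: mulgl_continuous; rewrite mulVg; exact: open_nbhs_nbhs.
apply: filterS => y /= Hy nHy; apply: nHx.
by have := HM _ _ nHy (HV _ Hy); rewrite invgM invgK mulVKg.
Qed.

Lemma zassenhaus2_min p K : (1 < p)%N -> is_subgroup K -> closed K ->
  (forall x, K (x ^+ p)) -> (forall x y, K [~ x, y]) -> zassenhaus p 2 `<=` K.
Proof.
move=> p1 gK cK Kp Kc; rewrite zassenhausE //.
apply: cgen_min => // x [[y _ <-]|[[j l] /= _]]; first exact: Kp.
by apply: cgen_min => // _ [y _ [z _ <-]]; exact: Kc.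
Qed.

(** A weak form of x^p in D_(pi), just enough for D_i / D_(i+1) to have exponent p. *)
Lemma zassenhaus_pow p i (x : G) : (1 < p)%N -> (0 < i)%N ->
  zassenhaus p i x -> zassenhaus p i.+1 (x ^+ p).
Proof.
move=> p1 i0 Dx; rewrite zassenhausE; [|lia..].
apply: sub_cgen; left; exists x => //.
have ci : ((i.+1 + p.-1) %/ p <= i)%N by rewrite -ltnS ltn_divLR; nia.
exact: (@zassenhaus_recS G p _ _ _ _ ci ci x Dx).
Qed.

Lemma zassenhaus_comm p i (x y : G) : (1 < p)%N -> (0 < i)%N ->
  zassenhaus p i x -> zassenhaus p i.+1 [~ x, y].
Proof.
move=> p1 i0 Dx; rewrite zassenhausE; [|lia..].
apply: sub_cgen; right; exists (i, 1%N); first by split=> //=; rewrite addn1.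
by apply: sub_cgen; exists x => //; exists y.
Qed.

Lemma zassenhausS p i j : (i <= j)%N -> @zassenhaus G p j `<=` zassenhaus p i.
Proof. by move=> ij; apply: zassenhaus_recS. Qed.

Lemma discrete_pro_p p : is_pro_p G p -> open [set (1 : G)] ->
  exists k, ([set: G] #= `I_(p ^ k)%N)%card.
Proof.
case=> _ Gi o1; have [||k Hk] := Gi [set 1] _ _ o1.
- by split=> [//|x y /= -> ->|x /= ->]; rewrite ?mulg1 ?invg1.
- by move=> x g /= ->; rewrite conj1g.
exists k; apply: card_eq_trans Hk.
have -> : lcoset_set [set (1 : G)] = [set [set x] | x in [set: G]].
  rewrite /lcoset_set; congr image; apply: funext => x.
  by rewrite image_set1 mulg1.
by rewrite card_eq_sym; apply: inj_card_eq => x y _ _ /seteqP[/(_ x erefl)].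
Qed.

End TopGroup.

Section SigmaGroup.
Variable G : sigmaGroupType.

Lemma squot_all_open (N : sigmaNormal G) (A : set (squot N)) :
  open (sigma_normal_set N) -> open A.
Proof.
move=> oN; rewrite squot_openE openE => x Ax.
have : nbhs x ((fun y => x^-1 * y) @^-1` N).
  apply: mulgl_continuous; rewrite mulVg; apply: open_nbhs_nbhs.
  by split=> //; case: (sigma_normal_subgroup N).
by apply: filterS => y /= /(squot_piP N) <-.
Qed.

Lemma squot_all_closed (N : sigmaNormal G) (A : set (squot N)) :
  open (sigma_normal_set N) -> closed A.
Proof. by move=> oN; rewrite -[A]setCK; apply/open_closedC/squot_all_open. Qed.

Lemma squot_card p (N : sigmaNormal G) : is_pro_p G p ->
  open (sigma_normal_set N) ->
  exists k, ([set: squot N] #= `I_(p ^ k)%N)%card.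
Proof.
by move=> Gp oN; apply: discrete_pro_p; [exact: is_pro_p_squot|exact: squot_all_open].
Qed.

Lemma squot_finite p (N : sigmaNormal G) : is_pro_p G p ->
  open (sigma_normal_set N) -> finite_set [set: squot N].
Proof. by move=> Gp /(squot_card Gp)[k]; exists (p ^ k)%N. Qed.

(** The intersection of all conjugates of [H] and of sigma [H] is open: by compactness of [G], one
    neighbourhood of 1 works for all conjugating elements at once (tube lemma). *)
Lemma open_subgroup_core (H : set G) : compact [set: G] -> is_subgroup H ->
  open H -> exists2 N : sigmaNormal G, open N & N `<=` H.
Proof.
move=> cG [H1 HM HV] oH.
pose K : set G := [set x | forall g, H (x ^ g) /\ H (sigma x ^ g)].
have s1 : sigma (1 : G) = 1 := morph1 (@sigmaM G).
have sV x : sigma (x^-1 : G) = (sigma x)^-1 := morphV (@sigmaM G) x.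
have gK : is_subgroup K.
  split=> [g|x y Kx Ky g|x Kx g]; first by rewrite s1 conj1g.
  - have [? ?] := Kx g; have [? ?] := Ky g.
    by rewrite sigmaM !conjMg; split; exact: HM.
  - by have [? ?] := Kx g; rewrite sV !conjVg; split; exact: HV.
have oK : open K.
  apply: subgroup_nbhs_open => //.
  have cj (s : G -> G) : continuous s -> s 1 = 1 ->
      \forall x \near (1 : G), forall g, H (s x ^ g).
    move=> sc s1'; have /compact_near_coveringP cov := cG.
    suff h (g : G) : \forall g' \near g & x \near (1 : G), H (s x ^ g').
      have F1 : Filter (nbhs (1 : G)) by exact: nbhs_filter.
      have := cov G (nbhs (1 : G)) (fun x g => H (s x ^ g)) F1 (fun g _ => h g).
      by apply: (@filterS _ _ F1) => x hx g; exact: hx.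
    pose f (z : G * G) : G := s z.2 ^ z.1.
    have fc : continuous f.
      move=> z; rewrite /f /conjg.
      pose h (z : G * G) := (z.1^-1, s z.2 * z.1) : G * G.
      apply: (@continuous_comp _ _ _ h (fun xy : G * G => xy.1 * xy.2));
        last exact: mulg_continuous.
      apply: cvg_pair.
        by apply: (@continuous_comp _ _ _ fst (fun x : G => x^-1));
          [exact: cvg_fst|exact: invg_continuous].
      pose h' (z : G * G) := (s z.2, z.1) : G * G.
      apply: (@continuous_comp _ _ _ h' (fun xy : G * G => xy.1 * xy.2));
        last exact: mulg_continuous.
      apply: cvg_pair; last exact: cvg_fst.
      by apply: (@continuous_comp _ _ _ snd s); [exact: cvg_snd|exact: sc].
    have : nbhs (g, (1 : G)) (f @^-1` H).
      by apply: fc; rewrite /f s1' conj1g; exact: open_nbhs_nbhs.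
    done.
  have F1 : Filter (nbhs (1 : G)) by exact: nbhs_filter.
  have h2 := cj sigma (@sigma_continuous G) s1.
  have h1 := cj id (fun _ => cvg_id) erefl.
  by apply: (@filterS2 _ _ F1 _ _ _ _ h1 h2) => x hx hx' g; split.
have nK : is_normal K.
  move=> x h Kx g; rewrite (morphJ (@sigmaM G)) -!conjgM.
  by split; [case: (Kx (h * g))|case: (Kx (sigma h * g))].
have sK x : K x -> K (sigma x) by move=> Kx g; rewrite sigmaK; case: (Kx g).
exists (SigmaNormal gK nK (open_subgroup_closed gK oK) sK) => // x Kx.
by have [] := Kx 1; rewrite conjg1.
Qed.

(** In [G / N] the conclusion says that the image of [g] is outside the image of [H]: a closed
    subgroup is determined by its images in these discrete quotients. *)
Lemma closed_subgroup_separation (H : set G) g : is_profinite G ->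
  is_subgroup H -> closed H -> ~ H g ->
  exists2 N : sigmaNormal G, open N & forall h, H h -> ~ (sigma_normal_set N) (h^-1 * g).
Proof.
move=> [cG _ bG] [H1 HM HV] cH nHg.
have [|V [gV oV VH]] := bG ((fun x => g * x) @^-1` (~` H)).
  apply: mulgl_continuous; rewrite mulg1; apply: open_nbhs_nbhs.
  by split=> //; exact: closed_openC.
have [N oN NV] := open_subgroup_core cG gV oV.
exists N => // h Hh Nhg; have [_ _ NI] := sigma_normal_subgroup N.
by apply: (VH _ (NV _ (NI _ Nhg))); rewrite /= invgM invgK mulVKg.
Qed.

(** An element outside [H] stays outside in some finite quotient. There D_2 maps into the Frattini
    subgroup, so that [H], which generates together with D_2, maps onto the quotient, a
    contradiction. *)
Lemma frattini p (H : set G) : prime p -> is_pro_p G p ->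
  is_subgroup H -> closed H ->
  (forall K, is_subgroup K -> closed K -> H `<=` K -> zassenhaus p 2 `<=` K ->
    K = setT) -> H = setT.
Proof.
move=> p_pr Gp gH cH HD; apply/seteqP; split=> // g _; apply: contrapT => nHg.
have [N oN Ng] := closed_subgroup_separation Gp.1 gH cH nHg.
have [k ck] := squot_card Gp oN.
have [Phi [gPhi Phip PhiC PhiF]] := FinitePGroup.finite_p_group_frattini p_pr ck.
have piM := @squot_piM _ N; have piC := @squot_pi_continuous _ N.
have cpre (A : set (squot N)) : closed (squot_pi N @^-1` A).
  by move/continuous_closedP: piC; apply; exact: squot_all_closed.
have DPhi : @zassenhaus G p 2 `<=` squot_pi N @^-1` Phi.
  apply: zassenhaus2_min (prime_gt1 p_pr) _ (cpre _) _ _.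
  - exact: preimage_subgroup.
  - by move=> x /=; rewrite (morphX piM).
  - by move=> x y /=; rewrite (morphR piM).
have [Phi1 PhiM PhiV] := gPhi; have [H1 HM HV] := gH.
have PhiJ x y : Phi x -> Phi (x ^ y).
  by move=> Px; rewrite -(mulVKg x (x ^ y)) -commgEl; exact: PhiM.
(* The preimage of the product of the image of [H] with [Phi]; it contains [H] and D_2. *)
pose L := squot_pi N @^-1` [set u | exists2 h, H h & Phi ((squot_pi N h)^-1 * u)].
have LT : L = setT.
  apply: HD (cpre _) _ _; first apply: (preimage_subgroup piM).
  - split=> [|u v [h Hh Phih] [k' Hk Phik]|u [h Hh Phih]].
    + by exists 1; rewrite // (morph1 piM) invg1 mulg1.
    + exists (h * k'); first exact: HM.
      have := PhiM _ _ (PhiJ _ (squot_pi N k') Phih) Phik.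
      by rewrite conjgE piM invgM !mulgA mulgK.
    + exists h^-1; first exact: HV.
      have := PhiJ _ (squot_pi N h)^-1 (PhiV _ Phih).
      by rewrite conjgE (morphV piM) invgM !invgK !mulgA mulgK.
  - by move=> h Hh; exists h; rewrite // mulVg.
  - by move=> d Dd; exists 1; rewrite // (morph1 piM) invg1 mul1g; exact: DPhi.
have /seteqP[_ /(_ (squot_pi N g) I)[h Hh /squot_piP]] :
    squot_pi N @` H = setT; last exact: Ng.
apply: PhiF; first exact: image_subgroup.
move=> u; have [x <-] := squot_pi_surj u.
have [h Hh Phih] : L x by rewrite LT.
by exists (squot_pi N h) => //; exists h.
Qed.

End SigmaGroup.

(** * Free pro-p groups *)

(** [Z] replaces the finite central subgroup generated by [S]. It consists of the ordered products
    of powers with exponents below [p]; stability under multiplication by [S] is all that is used of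
    the group structure. *)
Lemma finite_central_closure (Q : groupType) (p : nat) (S : set Q) : (0 < p)%N ->
  finite_set S -> (forall z g, S z -> z * g = g * z) ->
  (forall z, S z -> z ^+ p = 1) ->
  exists Z : set Q, [/\ finite_set Z, Z 1, forall z g, Z z -> z * g = g * z &
    forall z u, S z -> Z u -> Z (z * u)].
Proof.
move=> p0 /finite_seqP[s ->]; elim: s => [|z s IHs] sC sp.
  by exists [set 1]; split=> // z g ->; rewrite mul1g mulg1.
have [||Z [fZ Z1 ZC ZS]] := IHs.
- by move=> w g ws; apply: sC; rewrite /= inE ws orbT.
- by move=> w ws; apply: sp; rewrite /= inE ws orbT.
have zC g : z * g = g * z by apply: sC; rewrite /= inE eqxx.
have zXC k g : z ^+ k * g = g * z ^+ k.
  by elim: k => [|k IHk]; rewrite ?mul1g ?mulg1 // expgS -mulgA IHk mulgA zC mulgA.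
have zp : z ^+ p = 1 by apply: sp; rewrite /= inE eqxx.
exists [set z ^+ k * u | k in `I_p & u in Z]; split.
- exact: finite_image2 (finite_II _) fZ.
- by exists 0%N => //; exists 1; rewrite ?mulg1.
- by move=> _ g [k _ [u Zu <-]]; rewrite -mulgA (ZC u) // !mulgA zXC.
move=> w _ + [k kp [u Zu <-]]; rewrite /= inE => /orP[/eqP ->|ws].
  have [kp'|kp'] := ltnP k.+1 p.
    by exists k.+1 => //; exists u => //; rewrite expgS mulgA.
  have kE : k.+1 = p by apply/eqP; rewrite eqn_leq kp' [(_ <= _)%N]kp.
  by exists 0%N => //; exists u; rewrite // mulgA -expgS kE zp.
exists k => //; exists (w * u); first exact: ZS.
rewrite (mulgA (z ^+ k) w u) (zXC k w). by rewrite -(mulgA w).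
Qed.

Lemma finite_hausdorff_open (T : topologicalType) (A : set T) :
  hausdorff_space T -> finite_set [set: T] -> open A.
Proof.
move=> hT fT; rewrite -[A]setCK; apply: closed_openC.
apply: (accessible_finite_set_closed.1 (hausdorff_accessible hT)).
exact: sub_finite_set fT.
Qed.

Section FreeSigma.
Variables (p n : nat) (F : freeSigma p n).
Hypothesis p_pr : prime p.

Lemma free_pro_p : is_pro_p F p.
Proof. by case: (free_genP F). Qed.

Lemma free_hom_ex (H : topGroupType) (h : 'I_n -> H) : is_pro_p H p ->
  exists2 f : F -> H, is_cmorph f & forall i, f (free_gen F i) = h i.
Proof.
by move=> /((free_genP F).2 H h)[f [[fm fh] _]]; exists f.
Qed.

Lemma free_hom_uniq (H : topGroupType) (f g : F -> H) : is_pro_p H p ->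
  is_cmorph f -> is_cmorph g ->
  (forall i, f (free_gen F i) = g (free_gen F i)) -> f = g.
Proof.
move=> Hp fm gm fg; have [k [_ ku]] := (free_genP F).2 H (f \o free_gen F) Hp.
by transitivity k; [apply/esym|]; apply: ku; split=> // i; rewrite /= fg.
Qed.

(** [f] and its conjugate by sigma are two homomorphisms that agree on the generators, since sigma
    inverts both the generators and their images. *)
Lemma free_sigma_hom (H : sigmaGroupType) (f : F -> H) : is_pro_p H p ->
  is_cmorph f -> (forall i, minus_set (f (free_gen F i))) -> is_sigma_hom f.
Proof.
move=> Hp [fc fM] fi; split=> // x.
have : f = fun x => sigma (f (sigma x)).
  apply: free_hom_uniq => //.
    split=> [y|y z]; last by rewrite sigmaM fM sigmaM.
    apply: (@continuous_comp _ _ _ (f \o sigma)); last exact: sigma_continuous.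
    by apply: continuous_comp; [exact: sigma_continuous|exact: fc].
  by move=> i; rewrite sigma_free_gen (morphV fM) (morphV (@sigmaM H)) fi invgK.
by move=> /(congr1 (@^~ (sigma x))); rewrite sigmaK.
Qed.

(** If the subgroup were known to be normal, the projection to its quotient and the trivial map
    would agree on generators, hence everywhere. Adding D_2 makes it normal, because D_2 contains
    the commutators; the Frattini argument then removes D_2. *)
Lemma free_cgen : cgen (range (free_gen F)) = setT.
Proof.
pose K := cgen (range (free_gen F) `|` zassenhaus p 2).
have gK : is_subgroup K := cgen_subgroup _; have [K1 KM KV] := gK.
have DK : zassenhaus p 2 `<=` K by apply: subset_trans (@sub_cgen _ _); right.
have KT : K = setT.
  have nK : is_normal K.
    move=> x g Kx; rewrite -(mulVKg x (x ^ g)) -commgEl; apply: KM => //; apply: DK.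
    exact: zassenhaus_comm (prime_gt1 p_pr) _ _.
  have sK x : K x -> K (sigma x).
    apply: cgen_morph; [exact: sigmaM|exact: sigma_continuous|exact: gK|
      exact: cgen_closed|].
    move=> y [[i _ <-]|Dy]; last by apply: DK; exact: zassenhaus_sigma.
    by rewrite sigma_free_gen; apply: KV; apply: sub_cgen; left; exists i.
  pose N := SigmaNormal gK nK (@cgen_closed _ _) sK.
  have : squot_pi N = fun _ => 1.
    apply: free_hom_uniq.
    - exact: is_pro_p_squot free_pro_p.
    - exact: (squot_pi_hom N).1.
    - by split=> [x|x y]; [exact: cvg_cst|rewrite mulg1].
    - by move=> i; apply/squot_pi1; apply: sub_cgen; left; exists i.
  move=> /(congr1 (fun f => f _)) pi1.
  by apply/seteqP; split=> // x _; apply/(squot_pi1 N); exact: pi1.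
apply: (frattini p_pr free_pro_p (cgen_subgroup _) (@cgen_closed _ _)) => L gL cL HL DL.
apply/seteqP; split=> // x _; have : K x by rewrite KT.
apply: cgen_min => // y [[i _ <-]|/DL //]; apply: HL; apply: sub_cgen; by exists i.
Qed.

Lemma free_gen_ind (H : set F) : is_subgroup H -> closed H ->
  (forall i, H (free_gen F i)) -> H = setT.
Proof.
move=> gH cH Hi; apply/seteqP; split=> // x _.
have : cgen (range (free_gen F)) x by rewrite free_cgen.
by apply: cgen_min => // _ [i _ <-].
Qed.

(* D_i / D_(i+1) is central of exponent p.  If D_i has finite index, then, as in
   Schreier's lemma, the coset representatives times a finite subgroup of
   D_i / D_(i+1) are stable under the generators, so they are all of
   F / D_(i+1). *)
Lemma zassenhaus_open i : open (@zassenhaus F p i).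
Proof.
elim: i => [|[|i] IHi]; [exact: openT|exact: openT|].
have p1 := prime_gt1 p_pr.
pose D := zassenhaus_sn p F i.+1; pose W := zassenhaus_sn p F i.+2.
have Qp : is_pro_p (squot W) p by apply: is_pro_p_squot free_pro_p.
have piM := @squot_piM _ W; have piC := @squot_pi_continuous _ W.
have [_ hW _] := Qp.1.
pose L : set F := range (free_gen F) `|` range (fun i => (free_gen F i)^-1).
have fL : finite_set L by rewrite finite_setU; split; apply: finite_image.
have LV y : L y -> L y^-1 by case=> -[j _ <-]; [right|left]; exists j; rewrite ?invgK.
pose z (u : squot D) (y : F) : F := (repr (squot_pi D (repr u * y)))^-1 * (repr u * y).
have Dz u y : zassenhaus p i.+1 (z u y) by exact: (@squot_reprP _ D).
have DC d g : zassenhaus p i.+1 d -> squot_pi W d * g = g * squot_pi W d.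
  move=> Dd; have [x <-] := squot_pi_surj g.
  have : squot_pi W [~ d, x] = 1.
    by apply/squot_pi1; exact: (@zassenhaus_comm F p i.+1 d x p1 isT Dd).
  by rewrite (morphR piM) => /eqP/commgP.
have Dp d : zassenhaus p i.+1 d -> squot_pi W d ^+ p = 1.
  move=> Dd; rewrite -(morphX piM); apply/squot_pi1.
  exact: (@zassenhaus_pow F p i.+1 d p1 isT Dd).
have fD : finite_set [set: squot D] by exact: (squot_finite (N := D) free_pro_p IHi).
have [||||Z [fZ Z1 ZC ZS]] := @finite_central_closure _ p
  [set squot_pi W (z u y) | u in [set: squot D] & y in L].
- exact: ltnW.
- exact: finite_image2.
- by move=> _ g [u _ [y _ <-]]; exact: DC.
- by move=> _ [u _ [y _ <-]]; exact: Dp.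
pose X := [set squot_pi W (repr u) * v | u in [set: squot D] & v in Z].
have fX : finite_set X by exact: finite_image2.
have XL y w : L y -> X w -> X (w * squot_pi W y).
  move=> Ly [u _ [v Zv <-]]; exists (squot_pi D (repr u * y)) => //.
  exists (squot_pi W (z u y) * v); first by apply: ZS => //; exists u => //; exists y.
  by rewrite -mulgA (ZC v) // !mulgA -!piM /z mulVKg.
(* Asking for both [g] and its inverse makes the stabiliser of the finite set [X] a subgroup; it is
   closed because [X] is. *)
pose M : set F :=
  [set g | forall w, X w -> X (w * squot_pi W g) /\ X (w * (squot_pi W g)^-1)].
have cX : closed X.
  exact: (accessible_finite_set_closed.1 (hausdorff_accessible hW)).
have MT : M = setT.
  apply: free_gen_ind.
  - split=> [w Xw|x y Mx My w Xw|x Mx w /Mx[? ?]].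
    + by rewrite (morph1 piM) invg1 mulg1.
    + rewrite piM invgM !mulgA; split; first by apply My; apply Mx.
      by apply Mx; apply My.
    + by rewrite (morphV piM) invgK.
  - have -> : M = \bigcap_(w in X) ((fun g => w * squot_pi W g) @^-1` X `&`
       (fun g => w * squot_pi W g^-1) @^-1` X).
      apply/seteqP; split=> g Mg w Xw; have := Mg w Xw; rewrite /= (morphV piM) //.
    have wc (w : squot W) : continuous (fun g => w * squot_pi W g).
      by move=> g; apply: continuous_comp; [exact: piC|exact: mulgl_continuous].
    apply: closed_bigI => w _; apply: closedI.
      exact: ((continuous_closedP _).1 (wc w)).
    have wcV : continuous (fun g : F => w * squot_pi W g^-1).
      move=> g; apply: (@continuous_comp _ _ _ (fun g : F => g^-1)
        (fun g : F => w * squot_pi W g)); [exact: invg_continuous|exact: wc].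
    exact: ((continuous_closedP _).1 wcV).
  - by move=> j w Xw; rewrite -(morphV piM); split; apply: XL => //;
      [left|right]; exists j.
have fQ : finite_set [set: squot W].
  apply: sub_finite_set fX => v _.
  have [g gE] := squot_pi_surj ((squot_pi W (repr (1 : squot D)))^-1 * v).
  have Mg : M g by rewrite MT.
  have [|+ _] := Mg (squot_pi W (repr (1 : squot D))).
    by exists 1 => //; exists 1; rewrite ?mulg1.
  by rewrite gE mulVKg.
have := finite_hausdorff_open [set (1 : squot W)] hW fQ.
rewrite squot_openE; congr open; apply/seteqP; split=> x /=.
  by move/squot_pi1.
by move=> Wx; apply/squot_pi1.
Qed.

End FreeSigma.

(** * Coordinates modulo D_2 *)

(* The additive group of F_p, written multiplicatively and made discrete. *)
Definition Fp_group (p : nat) : Type := discrete_topology 'F_p.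

Section FpGroup.
Variable p : nat.
Local Notation T := (Fp_group p).

HB.instance Definition _ := DiscreteTopology.on T.

Definition Fp_mul (x y : T) : T := ((x : 'F_p) + (y : 'F_p))%R.
Definition Fp_inv (x : T) : T := (- (x : 'F_p))%R.
Definition Fp_one : T := (0 : 'F_p)%R.

Let mulA : associative Fp_mul. Proof. by move=> x y z; exact: addrA. Qed.
Let mul1 : left_id Fp_one Fp_mul. Proof. by move=> x; exact: add0r. Qed.
Let mulx1 : right_id Fp_one Fp_mul. Proof. by move=> x; exact: addr0. Qed.
Let mulV : left_inverse Fp_one Fp_inv Fp_mul. Proof. by move=> x; exact: addNr. Qed.
Let mulxV : right_inverse Fp_one Fp_inv Fp_mul. Proof. by move=> x; exact: addrN. Qed.

HB.instance Definition _ := isGroup.Build T mulA mul1 mulx1 mulV mulxV.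

Lemma discrete_continuous (U V : topologicalType) (f : U -> V) :
  (forall A : set U, open A) -> continuous f.
Proof. by move=> oU; apply/continuousP => A _; exact: oU. Qed.

Let mul_cont : continuous (fun xy : T * T => xy.1 * xy.2).
Proof.
apply: discrete_continuous => A; rewrite openE => -[x y] Axy.
exists ([set x], [set y]) => /=; first by split; exact: discrete_set1.
by move=> [_ _] /= [-> ->].
Qed.
Let inv_cont : continuous (fun x : T => x^-1).
Proof. by apply: discrete_continuous => A; exact: discrete_open. Qed.

HB.instance Definition _ := Group_isTopGroup.Build T mul_cont inv_cont.

Lemma Fp_mulE (x y : T) : (x * y)%g = ((x : 'F_p) + (y : 'F_p))%R.
Proof. by []. Qed.

Lemma Fp_group_pro_p : prime p -> is_pro_p T p.
Proof.
move=> p_pr.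
have cF : ([set: T] #= `I_p)%card.
  have <- : [set nat_of_ord (x : 'F_p) | x in [set: T]] = `I_p.
    apply/seteqP; split=> [_ [x _ <-] /=|k kp].
      by rewrite -[X in (_ < X)%N](Fp_cast p_pr); exact: ltn_ord.
    exists (k%:R : 'F_p)%R => //; rewrite val_Fp_nat //; exact: modn_small.
  by rewrite card_eq_sym; apply: inj_card_eq => x y _ _; exact: val_inj.
have fT : finite_set [set: T] by exists p.
split; first split.
- exact: finite_compact.
- exact: discrete_hausdorff.
- move=> U /nbhs_singleton U1; exists [set 1]; split=> [| |x ->//].
  + by split=> [//|x y /= -> ->|x /= ->]; rewrite ?mulg1 ?invg1.
  + exact: discrete_open.
move=> H [H1 HM HV] _ _; have [HT|/existsNP[a]] := pselect (forall x, H x -> x = 1).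
  exists 1%N; rewrite expn1; apply: card_eq_trans cF.
  have -> : lcoset_set H = [set [set x] | x in [set: T]].
    rewrite /lcoset_set; congr image; apply: funext => x.
    have -> : H = [set 1] by apply/seteqP; split=> [y /HT//|y ->].
    by rewrite image_set1 mulg1.
  by apply: inj_card_eq => x y _ _ /seteqP[/(_ x erefl)].
move=> /not_implyP[Ha a1]; exists 0%N.
have HT : H = setT.
  apply/seteqP; split=> // b _.
  have HX k : H (a ^+ k).
    by elim: k => [//|k IHk]; rewrite expgS; exact: HM.
  have XE k : a ^+ k = (a *+ k : 'F_p)%R.
    by elim: k => [//|k IHk]; rewrite expgS IHk mulrS.
  have := HX (nat_of_ord ((b : 'F_p) / (a : 'F_p))%R).
  rewrite XE -mulr_natl natr_Zp divfK //; exact/eqP.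
rewrite HT expn0; have -> : lcoset_set [set: T] = [set setT]; last exact: card_set1.
apply/seteqP; split=> [_ [x _ <-]|_ ->].
  by apply/seteqP; split=> // y _; exists (x^-1 * y); rewrite ?mulVKg.
by exists 1 => //; apply/seteqP; split=> // y _; exists y; rewrite ?mul1g.
Qed.

End FpGroup.

Section Coordinates.
Variables (p n : nat) (F : freeSigma p n).
Hypothesis p_pr : prime p.

Lemma H1_Fp_cmorph (G : topGroupType) (f : G -> 'F_p) :
  H1_Fp f <-> is_cmorph (f : G -> Fp_group p).
Proof.
split=> [[fM fo]|[fc fM]]; last first.
  by split=> // a; move/continuousP: fc; apply; exact: discrete_open.
split=> //; apply/continuousP => A _.
have -> : f @^-1` A = \bigcup_(a in A) f @^-1` [set a].
  by apply/seteqP; split=> [x Ax|x [a Aa] /= ->//]; exists (f x).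
by apply: bigcup_open => a _; exact: fo.
Qed.

Lemma free_H1_ex (a : 'I_n -> 'F_p) :
  exists2 f : F -> 'F_p, H1_Fp f & forall i, f (free_gen F i) = a i.
Proof.
have [f fm fa] := free_hom_ex F (a : 'I_n -> Fp_group p) (Fp_group_pro_p p_pr).
by exists f => //; apply/H1_Fp_cmorph.
Qed.

Lemma free_H1_uniq (f g : F -> 'F_p) : H1_Fp f -> H1_Fp g ->
  (forall i, f (free_gen F i) = g (free_gen F i)) -> f = g.
Proof.
move=> /H1_Fp_cmorph fm /H1_Fp_cmorph gm; apply: free_hom_uniq fm gm.
exact: Fp_group_pro_p.
Qed.

Lemma H1_Fp1 (G : topGroupType) (f : G -> 'F_p) : H1_Fp f -> f 1 = 0%R.
Proof. by case=> fM _; apply: (addrI (f 1)); rewrite -fM mulg1 addr0. Qed.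

Lemma H1_FpV (G : topGroupType) (f : G -> 'F_p) x : H1_Fp f -> f x^-1 = (- f x)%R.
Proof.
by move=> hf; apply: (addrI (f x)); rewrite -hf.1 mulgV H1_Fp1 // subrr.
Qed.

Lemma H1_FpX (G : topGroupType) (f : G -> 'F_p) x k : H1_Fp f ->
  f (x ^+ k) = (f x *+ k)%R.
Proof.
by move=> hf; elim: k => [|k IHk]; rewrite ?H1_Fp1 // expgS hf.1 IHk mulrS.
Qed.

Lemma H1_Fp_zassenhaus2 (G : topGroupType) (f : G -> 'F_p) x : H1_Fp f ->
  zassenhaus p 2 x -> f x = 0%R.
Proof.
move=> hf; suff : zassenhaus p 2 `<=` f @^-1` [set 0%R] by apply.
apply: zassenhaus2_min (prime_gt1 p_pr) _ _ _ _.
- split=> [|y z /= fy fz|y /= fy]; first exact: H1_Fp1.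
  + by rewrite hf.1 fy fz addr0.
  + by rewrite H1_FpV // fy oppr0.
- rewrite -[X in closed X]setCK; apply: open_closedC.
  have -> : ~` (f @^-1` [set 0%R]) = \bigcup_(a in [set~ 0%R]) f @^-1` [set a].
    by apply/seteqP; split=> [y fy|y [a ay] /= ->//]; exists (f y).
  by apply: bigcup_open => a _; exact: hf.2.
- by move=> y; rewrite /= H1_FpX // -mulr_natl pchar_Fp_0 // mul0r.
- move=> y z; rewrite /= commgEl conjgE !hf.1 !H1_FpV //.
  by rewrite addrCA addKr addNr.
Qed.

End Coordinates.

Section Coordinates.
Variables (p n : nat) (F : freeSigma p n).
Hypothesis p_pr : prime p.

Lemma free_coord_subproof : exists v : F -> 'rV['F_p]_n,
  (forall j, H1_Fp (fun x => v x ord0 j)) /\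
  forall i j, v (free_gen F i) ord0 j = (i == j)%:R%R.
Proof.
have [h hP] : {h : 'I_n -> F -> 'F_p & forall j,
    H1_Fp (h j) /\ forall i, h j (free_gen F i) = (i == j)%:R%R}.
  apply: (@choice _ _ (fun j (h : F -> 'F_p) => H1_Fp h /\
    forall i, h (free_gen F i) = (i == j)%:R%R)) => j.
  by have [f hf fE] := free_H1_ex F p_pr (fun i => (i == j)%:R%R); exists f.
exists (fun x => \row_j h j x)%R; split=> [j|i j]; last by rewrite mxE (hP j).2.
have -> : (fun x => (\row_j h j x)%R ord0 j) = h j.
  by apply: funext => x; rewrite mxE.
exact: (hP j).1.
Qed.

(** The isomorphism of F / D_2 with F_p^n that sends the generators to the standard basis, seen as a
    map on [F]. Its components are the basis of H^1 dual to the generators, which the universal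
    property provides. *)
Definition free_coord : F -> 'rV['F_p]_n := sval (cid free_coord_subproof).

Lemma free_coord_H1 j : H1_Fp (fun x => free_coord x ord0 j).
Proof. exact: (svalP (cid free_coord_subproof)).1. Qed.

Lemma free_coord_gen i j : free_coord (free_gen F i) ord0 j = (i == j)%:R%R.
Proof. exact: (svalP (cid free_coord_subproof)).2. Qed.

Lemma free_coordM x y : free_coord (x * y) = (free_coord x + free_coord y)%R.
Proof. by apply/rowP => j; rewrite mxE; exact: (free_coord_H1 j).1. Qed.

Lemma free_coord1 : free_coord 1 = 0%R.
Proof. by apply: (addrI (free_coord 1)); rewrite -free_coordM mulg1 addr0. Qed.

Lemma free_coordV x : free_coord x^-1 = (- free_coord x)%R.
Proof.
by apply: (addrI (free_coord x)); rewrite -free_coordM mulgV free_coord1 subrr.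
Qed.

Lemma free_coordX x k : free_coord (x ^+ k) = (free_coord x *+ k)%R.
Proof.
by elim: k => [|k IHk]; rewrite ?free_coord1 // expgS free_coordM IHk mulrS.
Qed.

Lemma free_coord_open A : open (free_coord @^-1` A).
Proof.
rewrite openE => x Ax.
have : \forall y \near x, forall j, free_coord y ord0 j = free_coord x ord0 j.
  apply: filter_forall => j; apply: open_nbhs_nbhs; split=> //.
  exact: (free_coord_H1 j).2.
by apply: filterS => y /= yx; have -> : free_coord y = free_coord x by apply/rowP.
Qed.

Lemma free_H1E (f : F -> 'F_p) x : H1_Fp f ->
  f x = (\sum_j f (free_gen F j) * free_coord x ord0 j)%R.
Proof.
move=> hf; pose g x := (\sum_j f (free_gen F j) * free_coord x ord0 j)%R.
suff /(congr1 (@^~ x)) : f = g by [].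
apply: (free_H1_uniq p_pr) => // [|i]; last first.
  rewrite /g (bigD1 i) //= free_coord_gen eqxx mulr1 big1 ?addr0 // => j ji.
  by rewrite free_coord_gen eq_sym (negbTE ji) mulr0.
apply/H1_Fp_cmorph; split=> [|y z]; last first.
  rewrite /g Fp_mulE -big_split; apply: eq_bigr => j _.
  by rewrite free_coordM mxE mulrDr.
have Fpc (a : 'I_n -> F -> 'F_p) : (forall j, H1_Fp (a j)) ->
    continuous ((fun x => \sum_j a j x)%R : F -> Fp_group p).
  move=> ha; pose s (l : seq 'I_n) (x : F) : Fp_group p := (\sum_(j <- l) a j x)%R.
  suff sc l : continuous (s l) by exact: sc.
  elim: l => [|j l IHl].
    have -> : s [::] = fun _ => 1 by apply: funext => u; rewrite /s big_nil.
    by move=> ?; exact: cvg_cst.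
  have -> : s (j :: l) = fun u => (a j u : Fp_group p) * s l u.
    by apply: funext => u; rewrite /s big_cons.
  move=> u; pose h (u : F) := (a j u : Fp_group p, s l u).
  apply: (@continuous_comp _ _ _ h (fun xy : Fp_group p * Fp_group p => xy.1 * xy.2));
    last exact: mulg_continuous.
  exact: (cvg_pair (((H1_Fp_cmorph _).1 (ha j)).1 u) (IHl u)).
apply: Fpc => j; apply/H1_Fp_cmorph; split=> [y|y z]; last first.
  by rewrite Fp_mulE free_coordM mxE mulrDr.
pose m : Fp_group p -> Fp_group p := fun c => (f (free_gen F j) * (c : 'F_p))%R.
apply: (@continuous_comp _ _ _ (fun x => free_coord x ord0 j : Fp_group p) m).
  exact: ((H1_Fp_cmorph _).1 (free_coord_H1 j)).1.
by apply: discrete_continuous => A; exact: discrete_open.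
Qed.

Lemma free_coord_sigma x : free_coord (sigma x) = (- free_coord x)%R.
Proof.
apply/rowP => j; rewrite mxE.
have hj := free_coord_H1 j; pose g x := (- free_coord (sigma x) ord0 j)%R.
suff -> : free_coord x ord0 j = g x by rewrite opprK.
have := @free_H1_uniq _ _ F p_pr (fun x => free_coord x ord0 j) g hj.
move=> /(_ _ _)/(congr1 (fun f => f x)); apply=> [|i].
  have [hc hM] := (H1_Fp_cmorph _).1 hj.
  apply/H1_Fp_cmorph; split=> [y|y z]; last first.
    by rewrite Fp_mulE /g sigmaM free_coordM mxE opprD.
  apply: (@continuous_comp _ _ _ (fun x => free_coord (sigma x) ord0 j : Fp_group p)
     (fun c => c^-1)); last exact: invg_continuous.
  apply: (@continuous_comp _ _ _ (@sigma F)
    (fun x => free_coord x ord0 j : Fp_group p)); [exact: sigma_continuous|exact: hc].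
by rewrite /g sigma_free_gen free_coordV mxE opprK.
Qed.

Lemma free_coord_surj (w : 'rV['F_p]_n) : exists x, free_coord x = w.
Proof.
suff [x xE] : exists x, forall j, free_coord x ord0 j = w ord0 j.
  by exists x; apply/rowP.
have h (l : seq 'I_n) : uniq l -> exists x, forall j,
    free_coord x ord0 j = (if j \in l then w ord0 j else 0)%R.
  elim: l => [|i l IHl] /=; first by exists 1 => j; rewrite free_coord1 mxE.
  move=> /andP[il /IHl[x xE]].
  exists (free_gen F i ^+ (w ord0 i : nat) * x) => j.
  rewrite free_coordM free_coordX mxE xE mulmxnE free_coord_gen inE eq_sym.
  have [->|ji] := eqVneq j i; last by rewrite mul0rn add0r.
  by rewrite (negbTE il) addr0 natr_Zp.
have [x xE] := h _ (enum_uniq 'I_n); exists x => j.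
by rewrite xE mem_enum.
Qed.

(** As F / D_2 is abelian of exponent p, the map [s] sending [w] to the product of the powers of the
    generators with exponents [w_j] is a homomorphism. Composed with the coordinates it agrees with
    the projection on generators, hence everywhere, so the coordinates determine the class modulo
    D_2. *)
Lemma free_coord_eq0 x : free_coord x = 0%R <-> zassenhaus p 2 x.
Proof.
split=> [x0|Dx]; last first.
  by apply/rowP => j; rewrite mxE; exact: (H1_Fp_zassenhaus2 p_pr (free_coord_H1 j) Dx).
have p1 := prime_gt1 p_pr.
pose D := zassenhaus_sn p F 2; pose a j := squot_pi D (free_gen F j).
have piM := @squot_piM _ D.
have ac (u v : squot D) : u * v = v * u.
  have [y <-] := squot_pi_surj u; have [z <-] := squot_pi_surj v.
  have : squot_pi D [~ y, z] = 1.
    by apply/squot_pi1; exact: (@zassenhaus_comm F p 1 y z p1 isT I).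
  by rewrite (morphR piM) => /eqP/commgP.
have ap (u : squot D) : u ^+ p = 1.
  have [y <-] := squot_pi_surj u; rewrite -(morphX piM); apply/squot_pi1.
  exact: (@zassenhaus_pow F p 1 y p1 isT I).
pose s (l : seq 'I_n) (w : 'rV['F_p]_n) :=
  foldr (fun j u => a j ^+ (w ord0 j : nat) * u) 1 l.
have aD (u : squot D) (b c : 'F_p) :
    u ^+ ((b + c)%R : nat) = u ^+ (b : nat) * u ^+ (c : nat).
  have -> : ((b + c)%R : nat) = ((b + c) %% p)%N.
    by rewrite -[b in LHS]natr_Zp -[c in LHS]natr_Zp -natrD val_Fp_nat.
  rewrite -expgnDr [in RHS](divn_eq (b + c) p) expgnDr mulnC expgnA ap.
  by rewrite expg1n mul1g.
have sD l w w' : s l (w + w')%R = s l w * s l w'.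
  elim: l => [|j l IHl] /=; first by rewrite mulg1.
  rewrite IHl mxE aD !mulgA; congr (_ * _); rewrite -!mulgA; congr (_ * _).
  exact: ac.
have s0 l : s l 0%R = 1.
  by elim: l => [//|j l IHl] /=; rewrite mxE IHl mulg1.
have sx l i : uniq l ->
    s l (free_coord (free_gen F i)) = if i \in l then a i else 1.
  elim: l => [//|j l IHl] /= /andP[jl ul].
  rewrite IHl // free_coord_gen inE.
  have [->|ij] := eqVneq i j; first by rewrite (negbTE jl) mulg1.
  by rewrite mul1g.
have : s (enum 'I_n) \o free_coord = squot_pi D.
  apply: free_hom_uniq.
  - exact: is_pro_p_squot (free_pro_p F).
  - split=> [y|y z /=]; last by rewrite free_coordM sD.
    have : continuous ((s (enum 'I_n) \o free_coord) : F -> squot D).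
      by apply/continuousP => A _; exact: (free_coord_open (s (enum 'I_n) @^-1` A)).
    exact.
  - exact: (squot_pi_hom D).1.
  - by move=> i; rewrite /= sx ?enum_uniq // mem_enum.
by move=> /(congr1 (fun f => f x)) /=; rewrite x0 s0 => /esym/squot_pi1.
Qed.

End Coordinates.

(** * Elimination of a generator *)

Lemma is_cmorph_comp (G H K : topGroupType) (f : G -> H) (g : H -> K) :
  is_cmorph f -> is_cmorph g -> is_cmorph (g \o f).
Proof.
case=> [fc fM] [gc gM]; split=> [x|x y /=]; last by rewrite fM gM.
by apply: continuous_comp; [exact: fc|exact: gc].
Qed.

Section Endo.
Variables (p n : nat) (F : freeSigma p n).

Lemma cmorph_image_closed (G : topGroupType) (f : F -> G) (A : set F) :
  hausdorff_space G -> continuous f -> closed A -> closed (f @` A).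
Proof.
move=> hG fc cA; apply: compact_closed => //; apply: continuous_compact.
  exact: continuous_subspaceT.
have [[cF _ _] _] := free_pro_p F.
exact: (subclosed_compact cA cF).
Qed.

(* The Hopf property: a finite quotient Q of F has only finitely many
   homomorphisms from F, so pi o f^i = pi o f^j for some i < j, and then
   pi = pi o f^(j-i) by surjectivity. *)
Lemma surj_endo_inj (f : F -> F) : is_cmorph f -> (forall x, exists y, f y = x) ->
  injective f.
Proof.
move=> fm fs; have [fc fM] := fm.
suff f1 x : f x = 1 -> x = 1.
  move=> x y xy; rewrite -(mulVKg x y) (f1 (x^-1 * y)) ?mulg1 //.
  by rewrite fM (morphV fM) xy mulVg.
move=> fx; apply: contrapT => x1.
have [_ hF _] := (free_pro_p F).1.
have g1 : is_subgroup [set (1 : F)].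
  by split=> [//|y z /= -> ->|y /= ->]; rewrite ?mulg1 ?invg1.
have c1 : closed [set (1 : F)].
  exact: (accessible_closed_set1 (hausdorff_accessible hF)).
have [N oN Nx] := closed_subgroup_separation (free_pro_p F).1 g1 c1 x1.
apply: (Nx 1 erefl); rewrite invg1 mul1g; apply/squot_pi1.
have Qp : is_pro_p (squot N) p := is_pro_p_squot N (free_pro_p F).
have fQ : finite_set [set: squot N] := squot_finite (free_pro_p F) oN.
pose s : seq (squot N) := fset_set [set: squot N].
have ms u : u \in s by rewrite in_fset_set ?inE.
pose e (u : squot N) : 'I_(size s) := Ordinal (etrans (index_mem u s) (ms u)).
have e_inj : injective e.
  move=> u v /(congr1 val) /= uv.
  by rewrite -(nth_index u (ms u)) uv nth_index.
pose phi k : {ffun 'I_n -> 'I_(size s)} :=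
  [ffun i => e (squot_pi N (iter k f (free_gen F i)))].
have iterm k : is_cmorph (iter k f).
  elim: k => [|k IHk] /=; first by split=> // y; exact: cvg_id.
  exact: (is_cmorph_comp IHk fm).
have iters k y : exists z, iter k f z = y.
  elim: k y => [|k IHk] y; first by exists y.
  by have [z <-] := fs y; have [w <-] := IHk z; exists w.
have [i [j [ij phiE]]] : exists i j : nat, (i < j)%N /\ phi i = phi j.
  pose M := #|{ffun 'I_n -> 'I_(size s)}|.
  have : ~~ injectiveb (fun k : 'I_M.+1 => phi k).
    apply/negP => /injectiveP /leq_card; rewrite card_ord.
    by rewrite ltnn.
  move=> /injectivePn[i [j ij phiE]].
  have [lij|lji|/val_inj eij] := ltngtP i j.
  - by exists i, j.
  - by exists j, i.
  - by rewrite eij eqxx in ij.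
have piE : squot_pi N \o iter i f = squot_pi N \o iter j f.
  apply: free_hom_uniq => // [||k].
  - exact: is_cmorph_comp (iterm _) (squot_pi_hom N).1.
  - exact: is_cmorph_comp (iterm _) (squot_pi_hom N).1.
  - by apply: e_inj; move: phiE => /ffunP/(_ k); rewrite !ffunE.
(* With x = f^i(z): pi(x) = pi(f^j(z)) = pi(f^(j-i)(x)), which is 1 because f(x) = 1 and i < j. *)
have [z zx] := iters i x; have /= := congr1 (@^~ z) piE.
have -> : j = ((j - i.+1).+1 + i)%N by lia.
rewrite iterD zx iterSr fx => ->.
by rewrite (morph1 (iterm _).2) (morph1 (@squot_piM _ N)).
Qed.

Hypothesis p_pr : prime p.

(** The exchange lemma for F / D_2. Dividing [y] by an element [z] of [K] with the same coordinates
    off [l], and raising to the inverse of the [l]-th coordinate, gives the [l]-th generator modulo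
    D_2. *)
Lemma frattini_gen (K : set F) l (y : F) : is_subgroup K ->
  zassenhaus p 2 `<=` K -> (forall j, j != l -> K (free_gen F j)) -> K y ->
  free_coord p_pr y ord0 l != 0%R -> K (free_gen F l).
Proof.
move=> gK DK Kj Ky yl; have [K1 KM KV] := gK.
pose v := free_coord p_pr y.
have KX x k : K x -> K (x ^+ k).
  by move=> Kx; elim: k => [//|k IHk]; rewrite expgS; exact: KM.
have [z Kz zE] : exists2 z, K z & forall j, free_coord p_pr z ord0 j =
    (if j != l then v ord0 j else 0)%R.
  suff [z Kz zE] : exists2 z, K z & forall j, free_coord p_pr z ord0 j =
      (if j \in [seq j <- enum 'I_n | j != l] then v ord0 j else 0)%R.
    by exists z => // j; rewrite zE mem_filter mem_enum andbT.
  elim: (enum 'I_n) (enum_uniq 'I_n) => [_|i s IHs /= /andP[i_s /IHs[z Kz zE]]].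
    by exists 1 => // j; rewrite free_coord1 mxE.
  case: ifPn => [il|]; last by exists z.
  exists (free_gen F i ^+ (v ord0 i : nat) * z) => [|j].
    by apply: KM => //; exact: KX (Kj _ il).
  rewrite free_coordM free_coordX mxE zE mulmxnE free_coord_gen inE eq_sym.
  have [->|ji] := eqVneq j i; last by rewrite mul0rn add0r.
  by rewrite mem_filter (negbTE i_s) andbF addr0 natr_Zp.
pose x := (z^-1 * y) ^+ ((v ord0 l)^-1%R : nat).
have Kx : K x by apply: KX; apply: KM => //; exact: KV.
rewrite -(mulVKg x (free_gen F l)); apply: KM => //; apply: DK.
apply/(free_coord_eq0 p_pr)/rowP => j.
rewrite free_coordM free_coordV free_coordX free_coordM free_coordV !mxE mulmxnE.
rewrite !mxE zE free_coord_gen -/v eq_sym; have [->|jl] := eqVneq j l.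
  by rewrite oppr0 add0r -[(_ *+ _)%R]mulr_natl natr_Zp mulVf // addNr.
by rewrite addNr mul0rn oppr0 addr0.
Qed.

End Endo.

(** The endomorphism replacing the [l]-th generator by [y] is onto by the exchange lemma and the
    Frattini argument, and injective by the Hopf property. Its inverse is continuous because [E] is
    compact and Hausdorff. *)
Lemma free_basis_change (p n : nat) (E : freeSigma p n) (p_pr : prime p) (l : 'I_n)
  (y : E) : minus_set y -> free_coord p_pr y ord0 l != 0%R ->
  exists f g : E -> E, [/\ is_sigma_hom f, is_sigma_hom g, cancel f g, cancel g f &
    forall i, f (free_gen E i) = if i == l then y else free_gen E i].
Proof.
move=> ym yl; have Ep := free_pro_p E.
have [f fm fx] := free_hom_ex E (fun i => if i == l then y else free_gen E i) Ep.
have fh : is_sigma_hom f.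
  apply: free_sigma_hom fm _ => // i; rewrite fx; case: eqP => // _.
  exact: sigma_free_gen.
have [cE hE _] := Ep.1; have [fc fM] := fm.
have cf A : closed A -> closed (f @` A) := @cmorph_image_closed _ _ E _ f A hE fc.
have gf : is_subgroup (range f) by apply: image_subgroup.
have fT : range f = setT.
  apply: (frattini p_pr Ep gf (cf _ closedT)) => K gK cK fK DK.
  have Kf i : K (f (free_gen E i)) by apply: fK; exists (free_gen E i).
  apply: (free_gen_ind p_pr gK cK) => i; have [->|il] := eqVneq i l.
    apply: (frattini_gen gK DK _ _ yl).
      by move=> j jl; have := Kf j; rewrite fx (negbTE jl).
    by have := Kf l; rewrite fx eqxx.
  by have := Kf i; rewrite fx (negbTE il).
have fs x : exists z, f z = x.
  by have : range f x by [rewrite fT]; move=> [z _ <-]; exists z.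
have f_inj := surj_endo_inj fm fs.
have [g gK] : {g : E -> E & forall x, f (g x) = x} := choice fs.
have fK : cancel f g by move=> x; apply: f_inj; rewrite gK.
exists f, g; split=> //; split; first split.
- apply/continuous_closedP => A cA; have -> : g @^-1` A = f @` A; last exact: cf.
  by apply/seteqP; split=> [x Agx|_ [z Az <-]]; [exists (g x)|rewrite /= fK].
- by move=> x z; apply: f_inj; rewrite fM !gK.
- by move=> x; apply: f_inj; rewrite fh.2 !gK.
Qed.

(** The last clause bounds the kernel of [f] from above: whatever quotient kills [y] does not
    distinguish [x] from [g (f x)]. Together with [f y = 1] it identifies the quotient of [E] by the
    normal closure of [y] with [E']. *)
Lemma free_elimination (p n : nat) (E : freeSigma p n.+1) (E' : freeSigma p n)
  (p_pr : prime p) (y : E) : minus_set y -> free_coord p_pr y != 0%R ->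
  exists (f : E -> E') (g : E' -> E), [/\ is_sigma_hom f, is_sigma_hom g,
    f y = 1, cancel g f &
    forall (N : sigmaNormal E) x, sigma_normal_set N y ->
      squot_pi N (g (f x)) = squot_pi N x].
Proof.
move=> ym y0; have Ep := free_pro_p E; have Ep' := free_pro_p E'.
have [l yl] : exists l, free_coord p_pr y ord0 l != 0%R.
  apply: contrapT => /forallNP h; move/eqP: y0; apply; apply/rowP => j.
  by rewrite mxE; apply/eqP/negP => /negP; exact: h.
have [th [th' [thh thh' thK thK' thx]]] := free_basis_change ym yl.
have [t tm tx] := free_hom_ex E
  (fun i => if unlift l i is Some j then free_gen E' j else 1) Ep'.
have [g gm gx] := free_hom_ex E' (fun j => free_gen E (lift l j)) Ep.
have th_hom : is_sigma_hom t.
  apply: free_sigma_hom tm _ => // i; rewrite tx.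
  by case: unliftP => [j _|_]; [exact: sigma_free_gen|exact: (set_mem (minus_set1 _))].
have gh : is_sigma_hom g.
  by apply: free_sigma_hom gm _ => // i; rewrite gx; exact: sigma_free_gen.
have tg : t \o g = id.
  apply: free_hom_uniq => // [||i].
  - exact: is_cmorph_comp gm tm.
  - by split=> // x; exact: cvg_id.
  - by rewrite /= gx tx liftK.
have thg : th \o g = g.
  apply: free_hom_uniq => // [|i]; first exact: is_cmorph_comp gm thh.1.
  by rewrite /= gx thx eq_sym (negbTE (neq_lift _ _)).
have thl : th (free_gen E l) = y by rewrite thx eqxx.
exists (t \o th'), g; split=> //.
- exact: is_sigma_hom_comp.
- by rewrite /= -thl thK tx unlift_none.
- move=> x /=; have := congr1 (@^~ x) thg => /= <-; rewrite thK.
  exact: (congr1 (@^~ x) tg).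
move=> N x Ny /=; rewrite -[in RHS](thK' x).
(* On the [l]-th generator one side is 1 and the other is the class of [y], which is trivial modulo
   [N]; on the other generators both maps are the inclusion. *)
have piE : squot_pi N \o (g \o t) = squot_pi N \o th.
  apply: (free_hom_uniq (is_pro_p_squot N Ep)) => [||i].
  - exact: is_cmorph_comp (is_cmorph_comp tm gm) (squot_pi_hom N).1.
  - exact: is_cmorph_comp thh.1 (squot_pi_hom N).1.
  rewrite /= tx thx; case: unliftP => [j ->|->].
    by rewrite gx eq_sym (negbTE (neq_lift _ _)).
  rewrite eqxx (morph1 gm.2) (morph1 (@squot_piM _ N)).
  by apply/esym/squot_pi1.
exact: (congr1 (@^~ (th' x)) piE).
Qed.

(** * Presentations *)

Lemma zassenhaus_zquot p (G : sigmaGroupType) i (u : zquot p G i) :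
  zassenhaus p i u -> u = 1.
Proof.
have [x <-] := squot_pi_surj u => Dx; apply/squot_pi1.
by apply: squot_zassenhaus_rec Dx.
Qed.

Section Presented.
Variable G : sigmaGroupType.
Implicit Types N M : sigmaNormal G.

Lemma squot_iso_eq N M : (sigma_normal_set N = sigma_normal_set M) ->
  sigma_iso (squot N) (squot M).
Proof.
move=> NM; apply: (@squot_iso _ _ _ _ (squot_pi M) (squot_pi N)).
- exact: squot_pi_hom.
- exact: squot_pi_hom.
- by move=> x Nx; apply/squot_pi1; rewrite -NM.
- by move=> x Mx; apply/squot_pi1; rewrite NM.
- move=> x y; split=> [/squot_piP|/esym/squot_piP]; rewrite -?NM => h.
    exact/esym/squot_piP.
  by apply/squot_piP; rewrite -NM.
Qed.

Lemma relator_sub n (r : n.-tuple (minus_part G)) N :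
  (forall j, sigma_normal_set N (val (tnth r j))) ->
  sigma_normal_set (relator_sn r) `<=` sigma_normal_set N.
Proof.
move=> Nr; apply: cgen_min.
- exact: sigma_normal_subgroup.
- exact: sigma_normal_closed.
by move=> _ [[j g] _ <-]; apply: sigma_normal_normal; exact: Nr.
Qed.

Lemma relator_mem n (r : n.-tuple (minus_part G)) j :
  sigma_normal_set (relator_sn r) (val (tnth r j)).
Proof.
by apply: sub_cgen; exists (j, 1) => //=; rewrite conjg1.
Qed.

Lemma relator_kill n (r : n.-tuple (minus_part G)) (H : sigmaGroupType)
  (f : G -> H) : hausdorff_space H -> is_sigma_hom f ->
  (forall j, f (val (tnth r j)) = 1) ->
  forall x, sigma_normal_set (relator_sn r) x -> f x = 1.
Proof.
move=> hH [[fc fM] _] fr x; have c1 : closed [set (1 : H)].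
  exact: (accessible_closed_set1 (hausdorff_accessible hH)).
apply: (@cgen_morph _ _ f fM fc _ [set 1]) => //.
  by split=> [//|y z /= -> ->|y /= ->]; rewrite ?mulg1 ?invg1.
by move=> _ [[j g] _ <-] /=; rewrite (morphJ fM) fr conj1g.
Qed.

(** The last hypothesis says that [w] is in the closed normal sigma-subgroup generated by the other
    relators. That subgroup contains sigma [w] too, so either [k]-th relator can be recovered from
    the other. *)
Lemma presented_row_operation n (r r' : n.-tuple (minus_part G)) k (w : G) :
  (forall j, j != k -> tnth r' j = tnth r j) ->
  val (tnth r' k) = w * val (tnth r k) * (sigma w)^-1 ->
  (forall N, (forall j, j != k -> sigma_normal_set N (val (tnth r j))) ->
    sigma_normal_set N w) ->
  sigma_iso (presented r) (presented r').
Proof.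
move=> r'E r'k Nw; apply: squot_iso_eq; apply/seteqP; split.
- apply: relator_sub => j; have [->|jk] := eqVneq j k; last first.
    by rewrite -r'E //; exact: relator_mem.
  have [_ NM NV] := sigma_normal_subgroup (relator_sn r').
  have Nw' : sigma_normal_set (relator_sn r') w.
    by apply: Nw => i ik; rewrite -r'E //; exact: relator_mem.
  have -> : val (tnth r k) = w^-1 * val (tnth r' k) * sigma w.
    by rewrite r'k !mulgA mulVg mul1g mulgVK.
  exact: (NM _ _ (NM _ _ (NV _ Nw') (@relator_mem _ r' k)) (sigma_normal_sigma Nw')).
- apply: relator_sub => j; have [->|jk] := eqVneq j k; last first.
    by rewrite r'E //; exact: relator_mem.
  have [_ NM NV] := sigma_normal_subgroup (relator_sn r).
  have Nw' : sigma_normal_set (relator_sn r) w.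
    by apply: Nw => i ik; exact: relator_mem.
  rewrite r'k.
  exact: (NM _ _ (NM _ _ Nw' (@relator_mem _ r k)) (NV _ (sigma_normal_sigma Nw'))).
Qed.

(** Each relator of one tuple becomes, in the group presented by the other, an element of D_i. Hence
    G_r / D_i depends only on the relators modulo D_i, which allows counting in finite quotients. *)
Lemma zquot_presented_congr p i n (r r' : n.-tuple (minus_part G)) :
  (forall j, zassenhaus p i ((val (tnth r j))^-1 * val (tnth r' j))) ->
  sigma_iso (zquot p (presented r) i) (zquot p (presented r') i).
Proof.
have wlg (s s' : n.-tuple (minus_part G)) :
    (forall j, zassenhaus p i ((val (tnth s j))^-1 * val (tnth s' j))) ->
  exists2 f : presented s -> zquot p (presented s') i, is_sigma_hom f &
    forall x, f (squot_pi (relator_sn s) x) = squot_pi _ (squot_pi (relator_sn s') x).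
  move=> ss'.
  have hom : is_sigma_hom
      (squot_pi (zassenhaus_sn p (presented s') i) \o squot_pi (relator_sn s')).
    by apply: is_sigma_hom_comp; exact: squot_pi_hom.
  apply: squot_lift hom _ => x sx.
  apply/squot_pi1.
  pose T := squot_pi (relator_sn s') @^-1` (zassenhaus p i).
  have gT : is_subgroup T.
    by apply: preimage_subgroup; [exact: squot_piM|exact: zassenhaus_rec_subgroup].
  suff : T x by []; move: x sx; apply: cgen_min => //.
    have := @squot_pi_continuous _ (relator_sn s').
    by move/continuous_closedP; apply; exact: zassenhaus_rec_closed.
  move=> _ [[j g] _ <-]; rewrite /T /= (morphJ (@squot_piM _ _)).
  apply: (@zassenhaus_normal p i).
  have [_ DM DV] := @zassenhaus_rec_subgroup (presented s') p i i.
  have /(zassenhaus_rec_morph (@squot_piM _ (relator_sn s'))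
    (@squot_pi_continuous _ _)) := ss' j.
  rewrite squot_piM (morphV (@squot_piM _ _)).
  rewrite ((squot_pi1 (relator_sn s') _).2 (relator_mem _)) mulg1 => /DV.
  by rewrite invgK.
move=> rr'; have r'r j : zassenhaus p i ((val (tnth r' j))^-1 * val (tnth r j)).
  have [_ _ DV] := @zassenhaus_rec_subgroup G p i i.
  by have := DV _ (rr' j); rewrite invgM invgK.
have [f fh fE] := wlg _ _ rr'; have [g gh gE] := wlg _ _ r'r.
have fD x : zassenhaus p i x -> f x = 1.
  by move=> Dx; apply: zassenhaus_zquot; apply: zassenhaus_rec_morph Dx; case: fh => -[].
have gD x : zassenhaus p i x -> g x = 1.
  by move=> Dx; apply: zassenhaus_zquot; apply: zassenhaus_rec_morph Dx; case: gh => -[].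
apply: (squot_iso fh gh) => // x y.
have [a <-] := squot_pi_surj x; have [b <-] := squot_pi_surj y; rewrite fE gE.
split=> /esym h; apply/esym.
  have /gD : zassenhaus p i ((squot_pi (relator_sn r') b)^-1 * squot_pi (relator_sn r') a).
    exact: ((squot_piP (zassenhaus_sn p (presented r') i) _ _).1 h).
  rewrite gh.1.2 (morphV gh.1.2) !gE.
  move=> /(congr1 (fun u => squot_pi _ (squot_pi _ b) * u)).
  by rewrite mulVKg mulg1 => ->.
have /fD : zassenhaus p i ((squot_pi (relator_sn r) a)^-1 * squot_pi (relator_sn r) b).
  exact: ((squot_piP (zassenhaus_sn p (presented r) i) _ _).1 h).
rewrite fh.1.2 (morphV fh.1.2) !fE.
move=> /(congr1 (fun u => squot_pi _ (squot_pi _ a) * u)).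
by rewrite mulVKg mulg1 => ->.
Qed.

End Presented.

Lemma presented_elimination p n (E : freeSigma p n.+1) (E' : freeSigma p n)
    (f : E -> E') (g : E' -> E) (r : n.+1.-tuple (minus_part E))
    (r' : n.-tuple (minus_part E')) k :
  is_sigma_hom f -> is_sigma_hom g -> cancel g f -> f (val (tnth r k)) = 1 ->
  (forall (N : sigmaNormal E) x, sigma_normal_set N (val (tnth r k)) ->
      squot_pi N (g (f x)) = squot_pi N x) ->
  (forall j, val (tnth r' j) = f (val (tnth r (lift k j)))) ->
  sigma_iso (presented r) (presented r').
Proof.
move=> fh gh gK fk gf r'E.
have hq (G : sigmaGroupType) (N : sigmaNormal G) :
    is_pro_p G p -> hausdorff_space (squot N).
  by move=> /(is_pro_p_squot N)[[]].
have gfN x := gf (relator_sn r) x (@relator_mem _ _ r k).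
have f1h := is_sigma_hom_comp fh (squot_pi_hom (relator_sn r')).
have g1h := is_sigma_hom_comp gh (squot_pi_hom (relator_sn r)).
have f1N x : sigma_normal_set (relator_sn r) x -> (squot_pi (relator_sn r') \o f) x = 1.
  apply: relator_kill => //; first exact: hq (free_pro_p E').
  move=> j /=; case: (unliftP k j) => [j' ->|->].
    by rewrite -r'E; apply/squot_pi1; exact: relator_mem.
  by rewrite fk (morph1 (@squot_piM _ _)).
have g1N x : sigma_normal_set (relator_sn r') x -> (squot_pi (relator_sn r) \o g) x = 1.
  apply: relator_kill => //; first exact: hq (free_pro_p E).
  by move=> j /=; rewrite r'E gfN; apply/squot_pi1; exact: relator_mem.
apply: (squot_iso f1h g1h) => // x y /=; split=> [/esym/squot_piP|/squot_piP].
  move=> /g1N; rewrite g1h.1.2 (morphV g1h.1.2) /= gfN.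
  move=> /(congr1 (fun u => squot_pi _ (g y) * u)).
  by rewrite mulVKg mulg1.
move=> /f1N; rewrite f1h.1.2 (morphV f1h.1.2) /= gK.
move=> /(congr1 (fun u => squot_pi _ y * u)).
by rewrite mulVKg mulg1.
Qed.

(** * First cohomology and the relator matrix *)

Lemma H1_Fp_comp p (G H : topGroupType) (f : G -> H) (h : H -> 'F_p) :
  is_cmorph f -> H1_Fp h -> H1_Fp (h \o f).
Proof.
move=> [fc fM] [hM ho]; split=> [x y /=|a]; first by rewrite fM hM.
by move/continuousP/(_ _ (ho a)): fc.
Qed.

(** Pullback along [f] is an isomorphism on H^1: injective because [f] is onto, surjective by the
    third hypothesis. *)
Lemma H1_dim_surj p m (G H : topGroupType) (f : G -> H) : is_cmorph f ->
  (forall y, exists x, f x = y) ->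
  (forall h : G -> 'F_p, H1_Fp h -> exists2 h', H1_Fp h' & h = h' \o f) ->
  H1_dim p G m <-> H1_dim p H m.
Proof.
move=> fm fs fh; split=> -[b [b1 bP]].
  have [b' b'P] : {b' : 'I_m -> H -> 'F_p & forall i, H1_Fp (b' i) /\ b i = b' i \o f}.
    apply: (@choice _ _ (fun i (h : H -> 'F_p) => H1_Fp h /\ b i = h \o f)) => i.
    by have [h ? ?] := fh _ (b1 i); exists h.
  exists b'; split=> [i|h hh]; first exact: (b'P i).1.
  have [c [cP cu]] := bP _ (H1_Fp_comp fm hh); exists c; split=> [y|c' c'P].
    have [x <-] := fs y; rewrite [LHS](cP x); apply: eq_bigr => i _.
    by rewrite (b'P i).2.
  apply: cu => x; rewrite [LHS]c'P; apply: eq_bigr => i _.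
  by rewrite (b'P i).2.
exists (fun i => b i \o f); split=> [i|h hh]; first exact: H1_Fp_comp.
have [h' hh' ->] := fh _ hh; have [c [cP cu]] := bP _ hh'.
exists c; split=> [x|c' c'P]; first exact: cP.
by apply: cu => y; have [x <-] := fs y; exact: c'P.
Qed.

Lemma H1_dim_iso p m (G H : sigmaGroupType) : sigma_iso G H ->
  H1_dim p G m <-> H1_dim p H m.
Proof.
case=> f [g [fh gh fK gK]]; apply: (H1_dim_surj _ fh.1) => [y|h hh].
  by exists (g y).
exists (h \o g); first exact: H1_Fp_comp gh.1 hh.
by apply: funext => x /=; rewrite fK.
Qed.

Lemma H1_Fp_squot p (G : sigmaGroupType) (N : sigmaNormal G) (h : G -> 'F_p) :
  H1_Fp h -> (forall x, sigma_normal_set N x -> h x = 0%R) ->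
  exists2 h', H1_Fp h' & h = h' \o squot_pi N.
Proof.
move=> hh hN; pose h' (u : squot N) := h (repr u).
have hE : h = h' \o squot_pi N.
  apply: funext => x /=; rewrite /h' -[in LHS](mulVKg (repr (squot_pi N x)) x).
  by rewrite hh.1 (hN _ (squot_reprP N x)) addr0.
exists h' => //; split=> [u v|a].
  have [x <-] := squot_pi_surj u; have [y <-] := squot_pi_surj v.
  rewrite -squot_piM -[LHS]/((h' \o squot_pi N) _) -hE hh.1 hE.
  by [].
rewrite squot_openE -[X in open X]/((h' \o squot_pi N) @^-1` [set a]) -hE.
exact: hh.2.
Qed.

Lemma H1_dim_zquot p m (G : sigmaGroupType) i : prime p -> (2 <= i)%N ->
  H1_dim p G m <-> H1_dim p (zquot p G i) m.
Proof.
move=> p_pr i2; apply: (H1_dim_surj _ (squot_pi_hom (zassenhaus_sn p G i)).1).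
  exact: squot_pi_surj.
move=> h hh; apply: H1_Fp_squot => // x /(zassenhausS i2).
exact: H1_Fp_zassenhaus2.
Qed.

Lemma card_mulmx_eq0 (K : finFieldType) (q n : nat) (M : 'M[K]_(q, n)) :
  #|[set c : 'rV[K]_q | (c *m M == 0)%R]%SET| = (#|K| ^ (q - \rank M))%N.
Proof.
pose B := row_base (kermx M).
have -> : [set c : 'rV[K]_q | (c *m M == 0)%R]%SET =
    finset.imset (fun d : 'rV[K]_(\rank (kermx M)) => (d *m B)%R) (mem predT).
  apply/setP => c; rewrite finset.inE; apply/eqP/imsetP => [cM|[d _ ->]].
    have /submxP[d ->] : (c <= B)%MS by rewrite eq_row_base; exact/sub_kermxP.
    by exists d.
  apply/sub_kermxP; apply: submx_trans (submxMl _ _) _.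
  by rewrite eq_row_base.
rewrite card_imset; last exact: (row_free_inj (row_base_free _)).
by rewrite -[LHS]/(#|{: 'rV[K]_(\rank (kermx M))}|) card_mx mul1n mxrank_ker.
Qed.

Section RelatorMatrix.
Variables (p n : nat) (F : freeSigma p n).
Hypothesis p_pr : prime p.

Definition relator_matrix q (r : q.-tuple (minus_part F)) : 'M['F_p]_(q, n) :=
  (\matrix_(i < q) free_coord p_pr (val (tnth r i)))%R.

(** H^1(G_r) is the space of classes in H^1(F) = F_p^n that vanish on the relators, that is, the
    kernel of the transposed matrix. The rows of [B], the values of a basis on the generators, form
    a basis of this kernel. *)
Lemma relator_matrix_rank q m (r : q.-tuple (minus_part F)) :
  H1_dim p (presented r) m -> (\rank (relator_matrix r) + m = n)%N.
Proof.
move=> [b [b1 bP]]; set M := relator_matrix r.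
have piM := squot_pi_hom (relator_sn r).
pose B : 'M['F_p]_(m, n) :=
  (\matrix_(i < m, j < n) b i (squot_pi _ (free_gen F j)))%R.
have bE (c : 'rV['F_p]_m) x : (\sum_i c ord0 i * b i (squot_pi (relator_sn r) x))%R =
    (\sum_j (c *m B)%R ord0 j * free_coord p_pr x ord0 j)%R.
  rewrite (eq_bigr (fun i => \sum_j c ord0 i * B i j * free_coord p_pr x ord0 j)%R).
    rewrite exchange_big /=; apply: eq_bigr => j _; rewrite mxE big_distrl.
    exact: eq_bigr.
  move=> i _; rewrite [b i _](free_H1E p_pr x (H1_Fp_comp piM.1 (b1 i))).
  rewrite big_distrr; apply: eq_bigr => j _ /=.
  by rewrite !mxE mulrA.
have Bfree : row_free B.
  apply: inj_row_free => c cB.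
  have h0 : H1_Fp (fun _ : presented r => 0%R : 'F_p).
    apply/H1_Fp_cmorph; split=> [x|x y]; last by rewrite Fp_mulE addr0.
    exact: (@cst_continuous _ (Fp_group p)).
  have [c0 [_ cu]] := bP _ h0.
  have cE : c0 = [ffun i => c ord0 i].
    apply: cu => u; have [x <-] := squot_pi_surj u.
    under eq_bigr do rewrite ffunE.
    by rewrite bE cB big1 // => j _; rewrite mxE mul0r.
  have c00 : c0 = [ffun i => 0%R].
    by apply: cu => u; rewrite big1 // => j _; rewrite ffunE mul0r.
  apply/rowP => i; have := congr1 (fun f : {ffun 'I_m -> 'F_p} => f i) cE.
  by rewrite c00 !ffunE mxE.
have BM : (B == kermx M^T)%MS.
  apply/andP; split.
    apply/sub_kermxP/matrixP => i j; rewrite !mxE.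
    have := free_H1E p_pr (val (tnth r j)) (H1_Fp_comp piM.1 (b1 i)).
    rewrite /= ((squot_pi1 (relator_sn r) _).2 (relator_mem j)) H1_Fp1 // => h.
    by rewrite [RHS]h; apply: eq_bigr => k _; rewrite !mxE.
  apply/rV_subP => v /sub_kermxP vM.
  (* Conversely, a vector of the kernel prescribes a class on [F] that kills the relators and
     therefore descends to G_r. *)
  have [h hh hx] := free_H1_ex F p_pr (fun j => v ord0 j).
  have hr x : sigma_normal_set (relator_sn r) x -> h x = 0%R.
    have [hc hM] := (H1_Fp_cmorph h).1 hh.
    apply: (@cgen_morph F (Fp_group p) h hM hc _ [set 1]).
    - by split=> [//|y z /= -> ->|y /= ->]; rewrite ?mulg1 ?invg1.
    - exact: discrete_closed.
    move=> _ [[j g] _ <-] /=; rewrite (morphJ hM).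
    suff -> : (h (val (tnth r j)) : Fp_group p) = 1 by rewrite conj1g.
    rewrite [LHS](free_H1E p_pr _ hh).
    have := congr1 (fun A : 'rV_q => A ord0 j) vM; rewrite !mxE => vj.
    by rewrite -[RHS]vj; apply: eq_bigr => k _; rewrite !mxE hx.
  have [h' hh' hE] := H1_Fp_squot hh hr.
  have [c [cP _]] := bP _ hh'.
  apply/submxP; exists (\row_i c i)%R; apply/rowP => j.
  rewrite -hx hE /= cP mxE; apply: eq_bigr => i _; by rewrite !mxE.
have := mxrank_ker M^T; rewrite -(eqmxP BM) mxrank_tr; move/eqP: Bfree => -> mE.
have := rank_leq_col M; lia.
Qed.

End RelatorMatrix.

(** * Haar measure and finite quotients *)

Section Haar.
Variables (R : realType) (G : sigmaGroupType) (mu : probability (minus_part G) R).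
Hypothesis haar_mu : is_haar mu.

Lemma measurable_minus_part (A : set (minus_part G)) : open A -> measurable A.
Proof. exact: sub_sigma_algebra. Qed.

Lemma haar_quotient (N : sigmaNormal G) : open (sigma_normal_set N) ->
  finite_set [set: squot N] ->
  exists (Q : finType) (c : minus_part G -> Q),
    uniform_map mu c /\
    forall a b, c a = c b <-> sigma_normal_set N ((val a)^-1 * val b).
Proof.
move=> oN fN.
have fm : finite_set (@minus_set (squot N)) by apply: sub_finite_set fN.
pose A := fset_set (@minus_set (squot N)).
have piA (a : minus_part G) : squot_pi N (val a) \in A.
  rewrite in_fset_set // inE /minus_set /= -(squot_pi_hom N).2 minus_partP.
  by rewrite (morphV (@squot_piM _ N)).
pose c a : A := [` piA a]%fset.
have cE q : c @^-1` [set q] = [set a | squot_pi N (val a) = val q].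
  apply/seteqP; split=> a /=; first by move=> <-.
  by move=> aq; exact: val_inj.
exists A, c; split; first split.
- move=> q; rewrite cE; apply: measurable_minus_part.
  have vc : continuous (fun a : minus_part G => val a : G).
    exact: (@initial_continuous (minus_part G) G val).
  have pc : continuous (fun a : minus_part G => squot_pi N (val a)).
    by move=> a; apply: continuous_comp; [exact: vc|exact: squot_pi_continuous].
  by move/continuousP: pc => /(_ [set val q]); apply; exact: squot_all_open.
- move=> q; rewrite cE haar_mu ?cardfE //.
  by have := valP q; rewrite in_fset_set // inE.
move=> a b; split=> [/(congr1 val)/squot_piP //|Nab].
by apply: val_inj; exact/squot_piP.
Qed.

(* Every fibre of [minus_part G -> G / N] has the same Haar measure, so it is
   enough that [f] is constant exactly on the cosets of [N]. *)
Lemma haar_fiber (N : sigmaNormal G) (B : Type) (f : minus_part G -> B) :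
  open (sigma_normal_set N) ->
  (forall a b, f a = f b <-> sigma_normal_set N ((val a)^-1 * val b)) ->
  exists x : \bar R, forall a, mu [set b | f b = f a] = x.
Proof.
move=> oN fN; exists ((#|` fset_set (@minus_set (squot N))|%fset)%:R^-1)%R%:E => a.
rewrite -(haar_mu oN (b := squot_pi N (val a))); last first.
  by rewrite /minus_set /= -(squot_pi_hom N).2 minus_partP (morphV (@squot_piM _ N)).
congr (mu _); apply/seteqP; split=> b /=.
  by move=> /esym/fN Nab; apply/esym/squot_piP.
by move=> /esym/squot_piP Nab; apply/esym/fN.
Qed.

End Haar.

(** A fibre of positive mass is not empty. In this way the surjectivity of F^- -> (F/N)^- is read
    off from the Haar measure, without any group theory. *)
Lemma uniform_map_surj (R : realType) (d : measure_display) (T : measurableType d)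
    (P : probability T R) (Q : finType) (c : T -> Q) :
  uniform_map P c -> forall q, exists t, c t = q.
Proof.
move=> [_ cQ] q; apply: contrapT => /forallNP h.
have c0 : c @^-1` [set q] = set0 by apply/seteqP; split=> // t /= /h.
have := cQ q; rewrite c0 measure0 => -[] /esym/eqP.
rewrite invr_eq0 pnatr_eq0 -leqn0 leqNgt => /negP; apply.
by apply/card_gt0P; exists q.
Qed.

Lemma card_ffun_preimage (A B : finType) (f : A -> B) (a n : nat)
    (S : {set {ffun 'I_n -> B}}) :
  (forall b, #|f @^-1: [set b]%SET| = a) ->
  #|[set q : {ffun 'I_n -> A} | [ffun j => f (q j)] \in S]%SET| = (#|S| * a ^ n)%N.
Proof.
move=> fa; rewrite -sum1_card.
rewrite (partition_big (fun q : {ffun 'I_n -> A} => [ffun j => f (q j)]) (mem S)) /=;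
  last by move=> q; rewrite finset.inE.
rewrite -sum_nat_const; apply: eq_bigr => b bS.
transitivity #|family (fun j => mem (f @^-1: [set b j]%SET))|.
  rewrite -sum1_card; apply: eq_bigl => q; rewrite finset.inE.
  apply/andP/familyP => [[_ /eqP qb] j|qb].
    by rewrite !finset.inE -qb ffunE.
  have qE : [ffun j => f (q j)] = b.
    apply/ffunP => j; rewrite ffunE; apply/eqP.
    by have := qb j; rewrite !finset.inE.
  by rewrite qE eqxx bS.
rewrite card_family foldrE big_map (eq_bigr (fun=> a)) => [|j _]; last exact: fa.
by rewrite big_enum /= prod_nat_const card_ord.
Qed.

Definition minus_elt (G : sigmaGroupType) (x : G) (h : minus_set x) : minus_part G :=
  exist _ x (mem_set h).

Lemma minus_twist (G : sigmaGroupType) (a : minus_part G) (w : G) :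
  minus_set (w * val a * (sigma w)^-1).
Proof.
rewrite /minus_set /= !sigmaM (morphV (@sigmaM G)) sigmaK minus_partP.
by rewrite !invgM invgK mulgA.
Qed.

Lemma minus_hom (G H : sigmaGroupType) (f : G -> H) (a : minus_part G) :
  is_sigma_hom f -> minus_set (f (val a)).
Proof. by move=> fh; rewrite /minus_set /= -fh.2 minus_partP (morphV fh.1.2). Qed.

Lemma sigma_normal_preimage (G H : sigmaGroupType) (f : G -> H) (M : sigmaNormal H) :
  is_sigma_hom f ->
  exists N : sigmaNormal G, sigma_normal_set N = f @^-1` (sigma_normal_set M).
Proof.
move=> [[fc fM] fs].
have gN : is_subgroup (f @^-1` (sigma_normal_set M)).
  by apply: preimage_subgroup => //; exact: sigma_normal_subgroup.
have nN : is_normal (f @^-1` (sigma_normal_set M)).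
  by move=> x g Mx; rewrite /= (morphJ fM); exact: sigma_normal_normal.
have cN : closed (f @^-1` (sigma_normal_set M)).
  by move/continuous_closedP: fc; apply; exact: sigma_normal_closed.
have sN x : (f @^-1` (sigma_normal_set M)) x -> (f @^-1` (sigma_normal_set M)) (sigma x).
  by move=> Mx; rewrite /= fs; exact: sigma_normal_sigma.
by exists (SigmaNormal gN nN cN sN).
Qed.

Lemma zassenhaus_sn_open p n (F : freeSigma p n) i : prime p ->
  open (sigma_normal_set (zassenhaus_sn p F i)).
Proof. by move=> p_pr; exact: (zassenhaus_open F p_pr i). Qed.

Lemma zassenhaus_sn_finite p n (F : freeSigma p n) i : prime p ->
  finite_set [set: squot (zassenhaus_sn p F i)].
Proof.
by move=> p_pr; apply: squot_finite (free_pro_p F) _; exact: zassenhaus_sn_open.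
Qed.

(** * Relators modulo D_i *)

Section Level.
Variables (R : realType) (p n i : nat) (E : freeSigma p n).
Variables (haar : probability (minus_part E) R).
Hypotheses (p_pr : prime p) (haarP : is_haar haar).

(** [Q] plays the role of (F/D_i)^- and [c] that of reduction modulo D_i; [rep] picks lifts, so that
    a tuple of residues can be tested on actual relators. *)
Definition level_map (Q : finType) (c : minus_part E -> Q) (rep : Q -> minus_part E) :=
  [/\ uniform_map haar c, cancel rep c &
    forall a b, c a = c b <-> zassenhaus p i ((val a)^-1 * val b)].

Lemma level_map_exists : exists (Q : finType) (c : minus_part E -> Q)
  (rep : Q -> minus_part E), level_map c rep.
Proof.
have oD := zassenhaus_sn_open E i p_pr.
have fD := zassenhaus_sn_finite E i p_pr.
have [Q [c [cu cE]]] := haar_quotient haarP oD fD.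
have [rep repK] := choice (uniform_map_surj cu).
by exists Q, c, rep.
Qed.

Hypothesis i2 : (2 <= i)%N.

Variables (Q : finType) (c : minus_part E -> Q) (rep : Q -> minus_part E).
Hypothesis cP : level_map c rep.

Lemma level_coord a : free_coord p_pr (val (rep (c a))) = free_coord p_pr (val a).
Proof.
have [_ cK cE] := cP; have /cE/(zassenhausS i2)/(free_coord_eq0 p_pr) := cK (c a).
by rewrite free_coordM free_coordV addrC => /eqP; rewrite subr_eq0 => /eqP.
Qed.

(** As sigma is -1 on F / D_2, every class there lies in the minus part. Its fibre in F^- has
    positive Haar measure, so it contains an element. *)
Lemma free_coord_minus_surj (w : 'rV['F_p]_n) :
  exists a : minus_part E, free_coord p_pr (val a) = w.
Proof.
have oD := zassenhaus_sn_open E 2 p_pr.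
have fD := zassenhaus_sn_finite E 2 p_pr.
have [x <-] := free_coord_surj E p_pr w.
have mx : minus_set (squot_pi (zassenhaus_sn p E 2) x).
  rewrite /minus_set /= -(squot_pi_hom _).2 -(morphV (@squot_piM _ _)).
  apply/squot_piP/(free_coord_eq0 p_pr).
  by rewrite free_coordM !free_coordV free_coord_sigma opprK addrN.
apply: contrapT => /forallNP h.
have := haarP oD mx; set A := [set _ | _].
have -> : A = set0.
  apply/seteqP; split=> // a /esym/squot_piP/(free_coord_eq0 p_pr).
  rewrite free_coordM free_coordV addrC => /eqP; rewrite subr_eq0 => /eqP /h.
  by [].
rewrite measure0 => -[] /esym/eqP; rewrite invr_eq0 pnatr_eq0 => /eqP/cardfs0_eq mm.
have : squot_pi (zassenhaus_sn p E 2) x \in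
    fset_set (@minus_set (squot (zassenhaus_sn p E 2))).
  by rewrite in_fset_set ?inE //; apply: sub_finite_set fD.
by rewrite mm inE.
Qed.

(** The fibres of the coordinates on F^- are those of reduction modulo D_2, so the p^n coordinate
    vectors are equally likely. *)
Lemma level_coord_card :
  (#|[set q | free_coord p_pr (val (rep q)) != 0%R]%SET| * p ^ n = #|Q| * (p ^ n - 1))%N.
Proof.
have oD := zassenhaus_sn_open E 2 p_pr; have [cu _ _] := cP.
have coE (a b : minus_part E) : free_coord p_pr (val a) = free_coord p_pr (val b) <->
    sigma_normal_set (zassenhaus_sn p E 2) ((val a)^-1 * val b).
  rewrite -[X in _ <-> X](free_coord_eq0 p_pr) free_coordM free_coordV addrC.
  split=> [->|/eqP]; first exact: subrr.
  by rewrite subr_eq0 => /eqP.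
have [x xE] := haar_fiber haarP oD coE.
have fE w : haar [set a | free_coord p_pr (val (rep (c a))) = w] = x.
  have [a <-] := free_coord_minus_surj w; rewrite -(xE a); congr (haar _).
  by apply/seteqP; split=> b /=; rewrite level_coord.
pose f (q : Q) : 'rV['F_p]_n := free_coord p_pr (val (rep q)).
have := @uniform_fiber_card _ _ _ _ _ 'rV['F_p]_n _ f x cu fE 0%R.
rewrite card_mx card_Fp // mul1n.
set Z := finset.preimset _ _ => ZQ.
have -> : [set q | free_coord p_pr (val (rep q)) != 0%R]%SET = ~: Z.
  by apply/setP => q; rewrite !finset.inE.
by have := cardsC Z; rewrite -ZQ mulnBr muln1; nia.
Qed.

End Level.

(** * Counting tuples of relators *)

Definition Sch_saturated p (F : forall n, freeSigma p n) (i : nat) (O : set (Sch F)) :=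
  forall x x' : presentation F, sigma_iso (zquot p (Gr x) i) (zquot p (Gr x') i) ->
    O (Sch_class (Gr_weak_schur x)) -> O (Sch_class (Gr_weak_schur x')).

Definition twist_word (G : groupType) n (s : seq 'I_n) (e : 'I_n -> nat)
    (x : 'I_n -> G) : G := foldr (fun j u => x j ^+ e j * u) 1 s.

Lemma twist_word_mem (G : sigmaGroupType) n (s : seq 'I_n) e (x : 'I_n -> G)
    (N : sigmaNormal G) :
  (forall j, j \in s -> sigma_normal_set N (x j)) ->
  sigma_normal_set N (twist_word s e x).
Proof.
have [N1 NM _] := sigma_normal_subgroup N.
have NX y k : sigma_normal_set N y -> sigma_normal_set N (y ^+ k).
  by move=> Ny; elim: k => [//|k IHk]; rewrite expgS; exact: NM.
elim: s => [//|j s IHs] Ns /=; apply: NM.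
  by apply: NX; apply: Ns; rewrite inE eqxx.
by apply: IHs => k ks; apply: Ns; rewrite inE ks orbT.
Qed.

Lemma free_coord_twist_word p n (F : freeSigma p n) (p_pr : prime p) l
    (s : seq 'I_l) e (x : 'I_l -> F) :
  free_coord p_pr (twist_word s e x) =
  (\sum_(j <- s) free_coord p_pr (x j) *+ e j)%R.
Proof.
elim: s => [|j s IHs]; first by rewrite big_nil free_coord1.
by rewrite big_cons /= free_coordM free_coordX IHs.
Qed.

Section RowOperation.
Variables (G : sigmaGroupType) (n p : nat) (v : 'rV['F_p]_n) (k : 'I_n).

(* With [r_k] replaced by [w r_k sigma(w)^-1], where [w] is the product of the
   [r_j ^ (v_j / 2 v_k)], the new relator is [sum_j v_j r_j / v_k] modulo [D_2]:
   [w] counts twice because sigma acts by [-1] there. *)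
Definition row_word (r : n.-tuple (minus_part G)) : G :=
  twist_word [seq j <- enum 'I_n | j != k]
    (fun j => (v ord0 j / (v ord0 k *+ 2))%R : nat) (fun j => val (tnth r j)).

Definition row_operation (r : n.-tuple (minus_part G)) : n.-tuple (minus_part G) :=
  [tuple if j == k then minus_elt (minus_twist (tnth r k) (row_word r)) else tnth r j
  | j < n].

Lemma row_operation_neq r j : j != k -> tnth (row_operation r) j = tnth r j.
Proof. by move=> jk; rewrite tnth_mktuple (negbTE jk). Qed.

Lemma row_operation_eq r : val (tnth (row_operation r) k) =
  row_word r * val (tnth r k) * (sigma (row_word r))^-1.
Proof. by rewrite tnth_mktuple eqxx. Qed.

Lemma row_operation_iso r : sigma_iso (presented r) (presented (row_operation r)).
Proof.
apply: presented_row_operation (row_operation_eq r) _ => [j|N Nr].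
  exact: row_operation_neq.
apply: twist_word_mem => j; rewrite mem_filter => /andP[jk _]; exact: Nr.
Qed.

End RowOperation.

Lemma free_coord_row_operation p n (F : freeSigma p n) (p_pr : prime p)
    l (v : 'rV['F_p]_l) k (r : l.-tuple (minus_part F)) :
  (2 < p)%N -> v ord0 k != 0%R ->
  free_coord p_pr (val (tnth (row_operation v k r) k)) =
  ((v ord0 k)^-1 *: (v *m relator_matrix p_pr r))%R.
Proof.
move=> p2 vk; rewrite row_operation_eq !free_coordM free_coordV free_coord_sigma opprK.
rewrite free_coord_twist_word big_filter big_enum_cond.
(* Here [p > 2] enters: the exponents in [row_word] are divided by 2. *)
have F2 : (2%:R != 0 :> 'F_p)%R.
  by apply/eqP => h; have := val_Fp_nat p_pr 2; rewrite h modn_small.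
rewrite -addrA addrC -addrA -mulr2n -sumrMnl mulmx_sum_row scaler_sumr.
rewrite [RHS](bigD1 k) // scalerA mulVf // scale1r rowK; congr (_ + _)%R.
apply: eq_bigr => j _; rewrite rowK scalerA -mulrnA -scaler_nat natrM natr_Zp.
congr (_ *: _)%R; rewrite -[(v ord0 k *+ 2)%R]mulr_natr invfM mulrA mulrVK ?unitfE //.
exact: mulrC.
Qed.

(** * Counting residue tuples for n and n + 1 relators *)

Section Count.
Variables (R : realType) (p : nat) (F : forall n, freeSigma p n).
Variable haar : forall n, probability (minus_part (F n)) R.
Hypotheses (p_pr : prime p) (p_gt2 : (2 < p)%N) (haarP : forall n, is_haar (haar n)).
Variables (i m : nat) (O : set (Sch F)).
Hypotheses (i2 : (2 <= i)%N) (satO : Sch_saturated i O).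
Hypothesis dimO : forall x : presentation F,
  O (Sch_class (Gr_weak_schur x)) -> H1_dim p (Gr x) m.

Lemma saturated_iso n n' (r : n.-tuple (minus_part (F n)))
    (r' : n'.-tuple (minus_part (F n'))) :
  sigma_iso (zquot p (presented r) i) (zquot p (presented r') i) ->
  O (Sch_of r) <-> O (Sch_of r').
Proof.
move=> rr'; split.
  exact: (@satO (existT _ n r) (existT _ n' r')).
exact: (@satO (existT _ n' r') (existT _ n r) (sigma_iso_sym rr')).
Qed.

Definition level_set n (Q : finType) (rep : Q -> minus_part (F n)) :
    {set {ffun 'I_n -> Q}} :=
  [set q : {ffun 'I_n -> Q} | `[< O (Sch_of [tuple rep (q j) | j < n]) >]]%SET.

Section OneLevel.
Variables (n : nat) (Q : finType) (c : minus_part (F n) -> Q).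
Variables (rep : Q -> minus_part (F n)).
Hypothesis cP : level_map i (haar n) c rep.

(** The choice of lifts is immaterial: congruent tuples present groups with the same quotient by
    D_i, and [O] sees only that quotient. *)
Lemma level_setE (r : n.-tuple (minus_part (F n))) :
  [ffun j => c (tnth r j)] \in level_set rep <-> O (Sch_of r).
Proof.
have [_ cK cE] := cP.
have -> : [ffun j => c (tnth r j)] \in level_set rep <->
    O (Sch_of [tuple rep ([ffun j => c (tnth r j)] j) | j < n]).
  by rewrite finset.inE; split=> /asboolP.
apply: saturated_iso; apply: zquot_presented_congr => j.
by apply/cE; rewrite tnth_mktuple ffunE cK.
Qed.

Let M (q : {ffun 'I_n -> Q}) := relator_matrix p_pr [tuple rep (q j) | j < n].

Lemma level_set_rank q : q \in level_set rep -> (\rank (M q) + m = n)%N.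
Proof.
rewrite finset.inE => /asboolP /(@dimO (existT _ n _)).
exact: relator_matrix_rank.
Qed.

Lemma level_set_double_count :
  (\sum_(v : 'rV['F_p]_n) #|[set q in level_set rep | (v *m M q != 0)%R]%SET| =
   #|level_set rep| * (p ^ n - p ^ m))%N.
Proof.
under eq_bigr => v _.
  rewrite -sum1_card; under eq_bigl do rewrite finset.inE; rewrite big_mkcondr.
over.
rewrite exchange_big /= -sum_nat_const; apply: eq_bigr => q qT.
rewrite -big_mkcond sum1_card.
have := cardsC [set v : 'rV['F_p]_n | (v *m M q == 0)%R]%SET.
rewrite card_mulmx_eq0 card_mx card_Fp // mul1n.
(* The matrix is square, so its left kernel, too, has dimension [m]. *)
have -> : (n - \rank (M q) = m)%N by have := level_set_rank qT; lia.
move=> <-; rewrite addKn; apply: eq_card => v.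
by rewrite !finset.inE.
Qed.

(** The row operation induces a map [phi] on residue tuples that preserves [level_set] and turns one
    condition into the other. Since the set of tuples is finite, injectivity of [phi] makes it a
    bijection. *)
Lemma level_set_row (v : 'rV['F_p]_n) k : v ord0 k != 0%R ->
  #|[set q in level_set rep | (v *m M q != 0)%R]%SET| =
  #|[set q in level_set rep | free_coord p_pr (val (rep (q k))) != 0%R]%SET|.
Proof.
move=> vk; have [_ cK cE] := cP.
pose lift_tuple (q : {ffun 'I_n -> Q}) := [tuple rep (q j) | j < n].
pose phi (q : {ffun 'I_n -> Q}) :=
  [ffun j => c (tnth (row_operation v k (lift_tuple q)) j)].
have liftK q : [ffun j => c (tnth (lift_tuple q) j)] = q.
  by apply/ffunP => j; rewrite ffunE tnth_mktuple cK.
have phi_inj : injective phi.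
  move=> q q' /ffunP qq'.
  have eq_neq j : j != k -> q j = q' j.
    by move=> jk; have := qq' j; rewrite !ffunE !row_operation_neq // !tnth_mktuple !cK.
  (* The word involves only the rows other than [k], which [phi] leaves alone; the twist of row [k]
     can then be undone. *)
  have ew : row_word v k (lift_tuple q) = row_word v k (lift_tuple q').
    rewrite /row_word; elim: (enum 'I_n) => [//|j s IHs] /=.
    by case: ifPn => //= jk; rewrite IHs !tnth_mktuple eq_neq.
  apply/ffunP => j; have [->|] := eqVneq j k; last exact: eq_neq.
  have := qq' k; rewrite !ffunE => /cE; rewrite !row_operation_eq ew !tnth_mktuple.
  set w := row_word _ _ _; set a := val _; set b := val _ => Dab.
  rewrite -[LHS]cK -[RHS]cK; apply/cE; rewrite -/a -/b.
  have := zassenhaus_normal (sigma w) Dab.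
  by rewrite conjgE !invgM invgK !mulgA mulVg mul1g !mulgVK.
rewrite -[RHS](on_card_preimset (f := phi)); last exact/onW_bij/injF_bij.
apply: eq_card => q; rewrite [LHS]finset.inE [RHS]finset.inE [RHS]finset.inE.
have -> : (q \in level_set rep) = (phi q \in level_set rep).
  apply/idP/idP.
    rewrite -{1}(liftK q) => /level_setE qO; apply/level_setE.
    exact: ((saturated_iso (zquot_iso p i (row_operation_iso v k _))).1 qO).
  move=> /level_setE qO; rewrite -(liftK q); apply/level_setE.
  exact: ((saturated_iso (zquot_iso p i (row_operation_iso v k _))).2 qO).
rewrite ffunE (level_coord p_pr i2 cP) free_coord_row_operation // scaler_eq0.
by rewrite invr_eq0 (negbTE vk).
Qed.

End OneLevel.

Section TwoLevels.
Variables (n : nat) (Q Q' : finType).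
Variables (c : minus_part (F n.+1) -> Q) (rep : Q -> minus_part (F n.+1)).
Variables (c' : minus_part (F n) -> Q') (rep' : Q' -> minus_part (F n)).
Hypotheses (cP : level_map i (haar n.+1) c rep) (cP' : level_map i (haar n) c' rep').

Let insert (k : 'I_n.+1) (y : Q) (q : {ffun 'I_n -> Q}) : {ffun 'I_n.+1 -> Q} :=
  [ffun j => if unlift k j is Some j' then q j' else y].

(** Once the [k]-th residue [y] is fixed, eliminating it leaves [n] relators of [F n], and the
    induced map [rho] on residues has fibres of equal size. Hence the slice, as a proportion of all
    choices of the other residues, does not depend on [y] and equals the proportion for [n]. *)
Lemma level_set_slice k y : free_coord p_pr (val (rep y)) != 0%R ->
  (#|[set q in level_set rep | q k == y]%SET| * #|Q'| ^ n =
   #|level_set rep'| * #|Q| ^ n)%N.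
Proof.
move=> y0; have [cu cK cE] := cP; have [cu' cK' cE'] := cP'.
have [f [g [fh gh fy gK gf]]] :=
  free_elimination (F n) (minus_partP (rep y)) y0.
pose fm a := minus_elt (minus_hom a fh); pose gm a := minus_elt (minus_hom a gh).
pose rho q := c' (fm (rep q)).
have rhoE a : rho (c a) = c' (fm a).
  apply/cE'; rewrite /= -(morphV fh.1.2) -fh.1.2.
  apply: (zassenhaus_rec_morph fh.1.2 fh.1.1).
  by apply/cE; rewrite cK.
(* The residue of [f a] is constant exactly on the cosets of the preimage of D_i, an open subgroup,
   so its fibres have equal Haar measure; the section [g] shows that none is empty. *)
have rho_fiber b : (#|rho @^-1: [set b]%SET| * #|Q'| = #|Q|)%N.
  have [N NE] := sigma_normal_preimage (zassenhaus_sn p (F n) i) fh.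
  have oN : open (sigma_normal_set N).
    rewrite NE; move/continuousP: fh.1.1; apply; exact: zassenhaus_sn_open.
  have [a b'|x xE] := haar_fiber (haarP (n := n.+1)) oN (f := c' \o fm) _.
    by rewrite NE /= fh.1.2 (morphV fh.1.2); exact: cE'.
  apply: (uniform_fiber_card cu (x := x)) => {}b.
  have [a <-] : exists a, (c' \o fm) a = b.
    exists (gm (rep' b)); rewrite -[RHS]cK' /=; congr (c' _); apply: val_inj.
    by rewrite /= gK.
  by rewrite -(xE a); congr (haar _ _); apply/seteqP; split=> t /=; rewrite rhoE.
have Q'0 : (0 < #|Q'|)%N by apply/card_gt0P; exists (rho y).
have fib b : #|rho @^-1: [set b]%SET| = (#|Q| %/ #|Q'|)%N.
  by rewrite -(rho_fiber b) mulnK.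
have insert_inj : injective (insert k y).
  move=> q q' /ffunP qq'; apply/ffunP => j.
  by have := qq' (lift k j); rewrite !ffunE liftK.
have -> : [set q in level_set rep | q k == y]%SET =
    finset.imset (insert k y) (mem [set q : {ffun 'I_n -> Q} |
      [ffun j => rho (q j)] \in level_set rep']%SET).
  have insertE q : insert k y q \in level_set rep <->
      [ffun j => rho (q j)] \in level_set rep'.
    pose r := [tuple rep (insert k y q j) | j < n.+1].
    pose r' := [tuple fm (rep (q j)) | j < n].
    have -> : insert k y q = [ffun j => c (tnth r j)].
      by apply/ffunP => j; rewrite [RHS]ffunE tnth_mktuple cK.
    have -> : [ffun j => rho (q j)] = [ffun j => c' (tnth r' j)].
      by apply/ffunP => j; rewrite !ffunE tnth_mktuple.
    rewrite (level_setE cP) (level_setE cP'); apply: saturated_iso; apply: zquot_iso.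
    have rk : tnth r k = rep y by rewrite tnth_mktuple ffunE unlift_none.
    apply: (presented_elimination fh gh gK (k := k)).
    - by rewrite rk.
    - by rewrite rk.
    - by move=> j; rewrite !tnth_mktuple ffunE liftK.
  apply/setP => q; apply/idP/imsetP.
    rewrite finset.inE => /andP[qT /eqP qk].
    exists [ffun j => q (lift k j)]; last first.
      apply/ffunP => j; rewrite ffunE; case: unliftP => [j' ->|->] //.
      by rewrite ffunE.
    rewrite finset.inE; apply/insertE.
    suff -> : insert k y [ffun j => q (lift k j)] = q by [].
    apply/ffunP => j; rewrite ffunE; case: unliftP => [j' ->|->] //.
    by rewrite ffunE.
  move=> [q']; rewrite finset.inE => /insertE q'T ->.
  by rewrite finset.inE q'T ffunE unlift_none eqxx.
rewrite card_imset // (card_ffun_preimage _ fib) -mulnA -expnMn.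
by congr (_ * _ ^ _)%N; rewrite -(fib (rho y)) rho_fiber.
Qed.

Lemma level_set_row_card k :
  (#|[set q in level_set rep | free_coord p_pr (val (rep (q k))) != 0%R]%SET| *
    p ^ n.+1 * #|Q'| ^ n = #|Q| ^ n.+1 * (p ^ n.+1 - 1) * #|level_set rep'|)%N.
Proof.
rewrite -sum1_card (partition_big (fun q : {ffun 'I_n.+1 -> Q} => q k)
  (mem [set y | free_coord p_pr (val (rep y)) != 0%R]%SET)) /=; last first.
  by move=> q; rewrite !finset.inE => /andP[].
rewrite -mulnA mulnC -mulnA big_distrr /=.
rewrite (eq_bigr (fun=> (#|level_set rep'| * #|Q| ^ n)%N)) => [|y]; last first.
  rewrite finset.inE => y0; rewrite -(level_set_slice k y0) mulnC; congr (_ * _)%N.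
  rewrite -sum1_card; apply: eq_bigl => q.
  rewrite !finset.inE; have [qk|_] := eqVneq (q k) y; last by rewrite !andbF.
  have -> : free_coord p_pr (val (rep (q k))) != 0%R by rewrite qk.
  by rewrite !andbT.
rewrite sum_nat_const (expnS #|Q|).
have := level_coord_card p_pr (@haarP n.+1) i2 cP.
set X := #|finset _|; set P := (p ^ n.+1)%N; set P1 := (P - 1)%N => XP.
transitivity ((X * P) * (#|level_set rep'| * #|Q| ^ n))%N; first by lia.
rewrite XP -!mulnA; congr (_ * _)%N; by rewrite mulnA mulnC.
Qed.

(** The zero vector contributes nothing to the double count, and each of the other p^(n+1) - 1
    vectors contributes the same number, found by summing slices. *)
Lemma level_set_step :
  (#|level_set rep| * (p ^ n.+1 - p ^ m) * (p ^ n.+1 * #|Q'| ^ n) =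
   (p ^ n.+1 - 1) ^ 2 * (#|Q| ^ n.+1 * #|level_set rep'|))%N.
Proof.
rewrite -(level_set_double_count rep) big_distrl /= (bigD1 0%R) //=.
rewrite (eq_bigr (fun=> #|Q| ^ n.+1 * (p ^ n.+1 - 1) * #|level_set rep'|)%N); last first.
  move=> v v0; have [k vk] : exists k, v ord0 k != 0%R.
    apply: contrapT => /forallNP h; move/eqP: v0; apply; apply/rowP => j.
    by rewrite mxE; apply/eqP/negP => /negP; exact: h.
  by rewrite (level_set_row cP vk) mulnA level_set_row_card.
rewrite sum_nat_const.
have -> : #|[set q in level_set rep | ((0 : 'rV['F_p]_n.+1) *m
    relator_matrix p_pr [tuple rep (q j) | j < n.+1] != 0)%R]%SET| = 0%N.
  apply/eqP; rewrite cards_eq0; apply/eqP/setP => q.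
  by rewrite !finset.inE mul0mx eqxx andbF.
have -> : #|(fun v : 'rV['F_p]_n.+1 => v != 0%R)| = (p ^ n.+1 - 1)%N.
  have := cardC (pred1 (0%R : 'rV['F_p]_n.+1)).
  rewrite card1 card_mx card_Fp // mul1n => <-.
  by rewrite add1n subn1 /=; apply: eq_card.
by rewrite mul0n add0n -mulnn -!mulnA; congr (_ * _)%N; rewrite mulnCA.
Qed.

End TwoLevels.
End Count.

Local Close Scope group_scope.
Local Open Scope ring_scope.

(** * The measures on Sch *)

Section SaturatedCore.
Variables (p : nat) (F : forall n, freeSigma p n).

Lemma Sch_of_surj (c : Sch F) :
  exists x : presentation F, c = Sch_class (Gr_weak_schur x).
Proof.
have [G [hG ->]] := Sch_class_surj c; have [_ [x Gx]] := hG.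
by exists x; apply/Sch_classP.
Qed.

Lemma Sch_mP m (x : presentation F) :
  Sch_m F m (Sch_class (Gr_weak_schur x)) <-> H1_dim p (Gr x) m.
Proof.
split=> [[G [hG [/Sch_classP xG Gm]]]|xm]; first exact/(H1_dim_iso p m xG).
by exists (Gr x), (Gr_weak_schur x).
Qed.

Lemma Sch_m_saturated m i : prime p -> (2 <= i)%N -> Sch_saturated i (Sch_m F m).
Proof.
move=> p_pr i2 x x' xx' /Sch_mP /(H1_dim_zquot m _ p_pr i2) xm; apply/Sch_mP.
by apply/(H1_dim_zquot m _ p_pr i2)/(H1_dim_iso p m xx').
Qed.

Lemma Sch_saturatedI i (A B : set (Sch F)) :
  Sch_saturated i A -> Sch_saturated i B -> Sch_saturated i (A `&` B).
Proof. by move=> sA sB x x' xx' [Ax Bx]; split; [exact: sA xx' _|exact: sB xx' _]. Qed.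

Lemma saturated_open i (O : set (Sch F)) : (2 <= i)%N -> Sch_saturated i O -> open O.
Proof.
move=> i2 sO; exists [set V | Sch_basis F V /\ V `<=` O] => [V []//|].
apply/seteqP; split=> [c [V [_ VO] Vc]|c Oc]; first exact: VO.
have [x cx] := Sch_of_surj c; exists (Sch_basic F i (Gr x)); last first.
  by exists (Gr x), (Gr_weak_schur x); split=> //; exact: sigma_iso_refl.
split; first by exists i, (Gr x); split=> //; exact: Gr_weak_schur.
move=> _ [H [hH [-> Hx]]]; have [_ [x' Hx']] := hH.
have -> : Sch_class hH = Sch_class (Gr_weak_schur x') by exact/Sch_classP.
move: Oc; rewrite cx; apply: sO.
exact: sigma_iso_trans (sigma_iso_sym Hx) (zquot_iso p i Hx').
Qed.

(** The union of those classes modulo D_i that lie inside [U]. This exhausts an open set by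
    countably many steps, whatever union of basic sets it was given as. *)
Definition saturated_core (U : set (Sch F)) (i : nat) : set (Sch F) :=
  [set c | exists2 x : presentation F, c = Sch_class (Gr_weak_schur x) &
    forall x' : presentation F, sigma_iso (zquot p (Gr x) i) (zquot p (Gr x') i) ->
      U (Sch_class (Gr_weak_schur x'))].

Lemma saturated_core_saturated U i : Sch_saturated i (saturated_core U i).
Proof.
move=> x x' xx' [y /Sch_classP xy yU]; exists x' => // z x'z; apply: yU.
apply: sigma_iso_trans (sigma_iso_trans xx' x'z).
exact: zquot_iso (sigma_iso_sym xy).
Qed.

Lemma saturated_coreS U i j : (i <= j)%N -> saturated_core U i `<=` saturated_core U j.
Proof.
move=> ij _ [x -> xU]; exists x => // x' xx'; apply: xU; exact: zquot_isoS xx'.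
Qed.

Lemma saturated_core_bigcup U : open U -> \bigcup_k saturated_core U k.+2 = U.
Proof.
move=> oU; apply/seteqP; split=> [_ [k _ [x -> xU]]|c Uc].
  by apply: xU; exact: sigma_iso_refl.
have [V [i [G [i2 hG VE]]] [Vc VU]] : exists2 V, Sch_basis F V & V c /\ V `<=` U.
  move: oU Uc => [D sD <-] [V DV Vc]; exists V; first exact: sD.
  by split=> // d Vd; exists V.
(* The basis starts at level 2, and index [k] of the union stands for level [k + 2]. *)
have [x cx] := Sch_of_surj c; exists (i - 2)%N => //; rewrite cx.
have -> : (i - 2).+2 = i by lia.
exists x => // x' xx'; apply: VU; rewrite VE.
move: Vc; rewrite VE cx => -[H [hH [/Sch_classP xH HG]]].
exists (Gr x'), (Gr_weak_schur x'); split=> //.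
apply: sigma_iso_trans (sigma_iso_sym xx') _.
exact: sigma_iso_trans (zquot_iso p i xH) HG.
Qed.

End SaturatedCore.

(** * From finite levels to Borel sets *)

Section Conclusion.
Variables (R : realType) (p : nat) (p_pr : prime p) (p_gt2 : (2 < p)%N).
Variable F : forall n : nat, freeSigma p n.
Variable haar : forall n : nat, probability (minus_part (F n)) R.
Hypothesis haarP : forall n : nat, is_haar (haar n).
Variable mut : forall n : nat, probability (n.-tuple (minus_part (F n))) R.
Hypothesis mutP : forall n : nat, is_product_measure (haar n) (mut n).

Lemma level_set_measure i n (O : set (Sch F)) (Q : finType)
    (c : minus_part (F n) -> Q) (rep : Q -> minus_part (F n)) :
  Sch_saturated i O -> level_map i (haar n) c rep ->
  measurable [set r : n.-tuple (minus_part (F n)) | O (Sch_of r)] /\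
  mut n [set r | O (Sch_of r)] = (#|level_set O rep|%:R / (#|Q| ^ n)%:R)%:E.
Proof.
move=> sO cP; have [cu _ _] := cP.
have -> : [set r : n.-tuple (minus_part (F n)) | O (Sch_of r)] =
    [set r | [ffun j => c (tnth r j)] \in level_set O rep].
  apply/seteqP; split=> r rO; first exact: ((level_setE sO cP r).2 rO).
  exact: ((level_setE sO cP r).1 rO).
exact: uniform_tuple.
Qed.

Lemma saturated_measurable i n (O : set (Sch F)) : Sch_saturated i O ->
  measurable [set r : n.-tuple (minus_part (F n)) | O (Sch_of r)].
Proof.
move=> sO; have [Q [c [rep cP]]] := level_map_exists i p_pr (@haarP n).
exact: (level_set_measure sO cP).1.
Qed.

Definition corank_weight (n m : nat) : R :=
  Cprod R p n ^+ 2 / (Cprod R p m ^+ 2 * Cprod R p (n - m)).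

Lemma Cprod_factor_neq0 k : (0 < k)%N -> 1 - p%:R ^- k != 0 :> R.
Proof.
move=> k0; rewrite subr_eq0 eq_sym invr_eq1 -natrX pnatr_eq1.
by rewrite -[1%N](expn0 p) eqn_exp2l ?prime_gt1 // -lt0n.
Qed.

Lemma CprodS k : Cprod R p k.+1 = Cprod R p k * (1 - p%:R ^- k.+1).
Proof. by rewrite /Cprod big_nat_recr. Qed.

Lemma Cprod_neq0 k : Cprod R p k != 0.
Proof.
elim: k => [|k IHk]; first by rewrite /Cprod big_geq ?oner_eq0.
by rewrite CprodS mulf_neq0 // Cprod_factor_neq0.
Qed.

Lemma corank_weight_ge0 n m : 0 <= corank_weight n m.
Proof.
have C0 k : 0 <= Cprod R p k.
  apply: prodr_ge0 => j _; rewrite subr_ge0 invf_le1 ?exprn_gt0 ?ltr0n ?prime_gt0 //.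
  by rewrite exprn_ege1 // ler1n prime_gt0.
by rewrite divr_ge0 ?mulr_ge0 ?exprn_ge0.
Qed.

Lemma corank_weightnn m : corank_weight m m = 1.
Proof.
rewrite /corank_weight subnn {3}/Cprod big_geq // mulr1 divff //.
by rewrite expf_neq0 ?Cprod_neq0.
Qed.

(** The recursion that [level_set_step] gives for the masses, with the denominators cleared. The
    weight is 1 at [n = m], so induction on [n] identifies the ratio. *)
Lemma corank_weightS n m : (m <= n)%N ->
  corank_weight n.+1 m * (p%:R ^+ n.+1 - p%:R ^+ m) * p%:R ^+ n.+1 =
  (p%:R ^+ n.+1 - 1) ^+ 2 * corank_weight n m.
Proof.
move=> mn; have p0 : p%:R != 0 :> R by rewrite pnatr_eq0 -lt0n prime_gt0.
rewrite /corank_weight subSn // !CprodS.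
have c1 := Cprod_neq0 m; have c2 := Cprod_neq0 (n - m).
have c3 : 1 - p%:R ^- (n - m).+1 != 0 :> R by exact: Cprod_factor_neq0.
have pm : p%:R ^+ n.+1 = p%:R ^+ (n - m).+1 * p%:R ^+ m :> R.
  by rewrite -exprD; congr (_ ^+ _); lia.
have q0 : p%:R ^+ n.+1 != 0 :> R by rewrite expf_neq0.
have q1 : p%:R ^+ (n - m).+1 != 0 :> R by rewrite expf_neq0.
have -> : p%:R ^+ n.+1 - p%:R ^+ m = p%:R ^+ n.+1 * (1 - p%:R ^- (n - m).+1) :> R.
  by rewrite mulrBr mulr1; congr (_ - _); rewrite pm mulrAC mulfV // mul1r.
have -> : p%:R ^+ n.+1 - 1 = p%:R ^+ n.+1 * (1 - p%:R ^- n.+1) :> R.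
  by rewrite mulrBr mulr1 mulfV.
move: c3 c1 c2 q0; set a := 1 - _; set b := Cprod _ _ m; set c := Cprod _ _ (n - m).
set d := _ ^+ n.+1; set e := Cprod R p n; set f := 1 - _ => a0 b0 c0 d0.
have -> : (e * f) ^+ 2 / (b ^+ 2 * (c * a)) = (e * f) ^+ 2 / (b ^+ 2 * c) / a.
  by rewrite mulrA (invfM (b ^+ 2 * c)) mulrA.
have aK u : u / a * (d * a) * d = d ^+ 2 * u.
  by rewrite (mulrC d a) mulrA divfK // -mulrA -expr2 mulrC.
rewrite aK !exprMn -[RHS]mulrA; congr (_ * _).
by rewrite [RHS]mulrA (mulrC (e ^+ 2)).
Qed.

Lemma saturated_proportional i m n (O : set (Sch F)) : (2 <= i)%N ->
  Sch_saturated i O -> O `<=` Sch_m F m -> (m <= n)%N ->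
  mut n [set r | O (Sch_of r)] =
  ((corank_weight n m)%:E * mut m [set r | O (Sch_of r)])%E.
Proof.
move=> i2 sO Om; have dO x : O (Sch_class (Gr_weak_schur x)) -> H1_dim p (Gr x) m.
  by move=> /Om /Sch_mP.
elim: n => [|n IHn]; first by rewrite leqn0 => /eqP ->; rewrite corank_weightnn mul1e.
rewrite leq_eqVlt => /predU1P[<-|mn]; first by rewrite corank_weightnn mul1e.
have {}IHn := IHn mn.
have [Q [c [rep cP]]] := level_map_exists i p_pr (@haarP n.+1).
have [Q' [c' [rep' cP']]] := level_map_exists i p_pr (@haarP n).
have := level_set_step p_pr p_gt2 haarP i2 sO dO cP cP'.
have [_ mE] := level_set_measure sO cP; have [_ mE'] := level_set_measure sO cP'.
(* A level for [m] as well, so that all three masses are real numbers and factors can be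
   cancelled. *)
have [Q'' [c'' [rep'' cP'']]] := level_map_exists i p_pr (@haarP m).
have [_ mE''] := level_set_measure sO cP''.
move: IHn; rewrite mE mE' mE'' -EFinM => -[IHn] step; rewrite -EFinM; congr EFin.
have p1 := prime_gt1 p_pr.
have Q0 : (0 < #|Q|)%N by apply/card_gt0P; exists (c point).
have Q'0 : (0 < #|Q'|)%N by apply/card_gt0P; exists (c' point).
have Qn0 : (#|Q| ^ n.+1)%:R != 0 :> R by rewrite pnatr_eq0 -lt0n expn_gt0 Q0.
have Q'n0 : (#|Q'| ^ n)%:R != 0 :> R by rewrite pnatr_eq0 -lt0n expn_gt0 Q'0.
have := congr1 (fun k : nat => k%:R : R) step; rewrite -mulnn !natrM.
rewrite !natrB ?expn_gt0 ?prime_gt0 // ?leq_exp2l // ?leqW //.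
rewrite (natrX _ p n.+1) (natrX _ p m).
set P := p%:R ^+ n.+1; set pm := p%:R ^+ m => stepR.
have P0 : P != 0 by rewrite expf_neq0 // pnatr_eq0 -lt0n prime_gt0.
have Pm0 : P - pm != 0.
  rewrite /P /pm subr_eq0 -!natrX eqr_nat eqn_exp2l //; lia.
apply: (mulIf (mulf_neq0 Pm0 P0)).
rewrite [RHS]mulrAC [X in _ = X * _]mulrA corank_weightS // -[RHS]mulrA -IHn.
rewrite mulrAC [RHS]mulrA; apply/eqP; rewrite eqr_div //; apply/eqP.
by rewrite -/P expr2 -[RHS]mulrA [X in _ = _ * X]mulrC -stepR -!mulrA.
Qed.

(** The saturated cores write the preimage of an open set as a countable union of sets that are
    decided modulo some D_i. *)
Lemma Sch_of_measurable n :
  measurable_fun [set: n.-tuple (minus_part (F n))] (@Sch_of p F n).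
Proof.
apply: (@measurability _ _ _ _ _ _ (@open (Sch F))) => // _ [U oU <-].
rewrite setTI -(saturated_core_bigcup oU) preimage_bigcup.
apply: bigcupT_measurable => k.
exact: saturated_measurable (@saturated_core_saturated _ _ U k.+2).
Qed.

Lemma Sch_m_measurable m : measurable (Sch_m F m).
Proof.
apply: sub_sigma_algebra; exact: (saturated_open (leqnn 2) (Sch_m_saturated p_pr (leqnn 2))).
Qed.

(** Continuity from below along the cores: the ratio of the two masses is the same at every level,
    so it passes to the limit. *)
Lemma Sch_mu_open m n (U : set (Sch F)) : (m <= n)%N -> open U ->
  Sch_mu (mut n) (U `&` Sch_m F m) =
  ((corank_weight n m)%:E * Sch_mu (mut m) (U `&` Sch_m F m))%E.
Proof.
move=> mn oU.
pose C k := saturated_core U k.+2 `&` Sch_m F m.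
have UE : U `&` Sch_m F m = \bigcup_k C k.
  by rewrite -setI_bigcupl saturated_core_bigcup.
have sC k : Sch_saturated k.+2 (C k).
  by apply: Sch_saturatedI; [exact: saturated_core_saturated|exact: Sch_m_saturated].
have mC l k : measurable (@Sch_of p F l @^-1` (C k)).
  exact: saturated_measurable (sC k).
have cvgC l : (mut l (@Sch_of p F l @^-1` (C k)) @[k --> \oo] -->
    Sch_mu (mut l) (U `&` Sch_m F m))%classic.
  rewrite /Sch_mu /pushforward UE preimage_bigcup; apply: nondecreasing_cvg_mu => //.
    exact: bigcupT_measurable.
  move=> k k' kk'; apply/subsetPset => r [Ur rm]; split=> //.
  by apply: (saturated_coreS _ Ur); rewrite !ltnS.
have eqC k : mut n (@Sch_of p F n @^-1` (C k)) =
    ((corank_weight n m)%:E * mut m (@Sch_of p F m @^-1` (C k)))%E.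
  by apply: (saturated_proportional (i := k.+2)) => // c [].
have := cvgC n; rewrite (funext eqC) => cn.
by apply: (cvg_unique (@ereal_hausdorff R) cn); apply: cvgeZl => //; exact: cvgC.
Qed.

End Conclusion.


Local Open Scope ereal_scope.

Theorem proposition9p6 (R : realType) (p : nat) (p_prime : prime p)
    (p_gt2 : (2 < p)%N)
    (F : forall n : nat, freeSigma p n)
    (haar : forall n : nat, probability (minus_part (F n)) R)
    (haarP : forall n : nat, is_haar (haar n))
    (mut : forall n : nat, probability (n.-tuple (minus_part (F n))) R)
    (mutP : forall n : nat, is_product_measure (haar n) (mut n))
    (n m : nat) (le_mn : (m <= n)%N)
    (A : set (Sch F)) (mA : measurable A) :
  Sch_mu (mut n) (A `&` Sch_m F m) =
  (Cprod R p n ^+ 2 / (Cprod R p m ^+ 2 * Cprod R p (n - m)))%:E *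
  Sch_mu (mut m) (A `&` Sch_m F m).
Proof.
have w0 := corank_weight_ge0 R p_prime n m.
have mSm : measurable (Sch_m F m) := Sch_m_measurable p_prime m.
pose X l : {mfun (l.-tuple (minus_part (F l))) >-> Sch F} :=
  mfun_Sub (mem_set (@Sch_of_measurable R p p_prime F haar haarP mut mutP l)).
(* Cutting down to [Sch_m] turns both sides into measures in [A]. *)
pose mu l : {measure set (Sch F) -> \bar R} :=
  mrestr (distribution (mut l) (X l)) mSm.
have muE l B : mu l B = Sch_mu (mut l) (B `&` Sch_m F m) by [].
suff /(_ A mA) : forall B, <<s @open (Sch F) >> B ->
    mu n B = mscale (NngNum w0) (mu m) B by [].
(* The open sets are stable under intersection and generate the Borel sets. The constant sequence
   [setT] is the required cover by open sets of finite mass. *)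
apply: (@g_sigma_algebra_measure_unique _ _ _ (@open (Sch F)) _ (fun=> setT)).
- exact: sub_sigma_algebra.
- by move=> _; exact: openT.
- by rewrite bigcup_const.
- exact: openI.
- move=> U oU.
  exact: (Sch_mu_open p_prime p_gt2 haarP mutP le_mn oU).
- move=> _; apply: (@le_lt_trans _ _ 1%E); last exact: ltry.
  have mS := @Sch_of_measurable R p p_prime F haar haarP mut mutP n.
  have mY : measurable (setT `&` Sch_m F m) by exact: measurableI.
  by apply: probability_le1; have := mS measurableT _ mY; rewrite setTI.
Qed.
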